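(* Let $f_0:[-1,1]\to\mathbb{R}$ be a nondecreasing square-integrable function, continuous at $0$, with $f_0(0)=0$; let $F_0(t)=\int_0^t f_0(s)\,ds$ and assume $F_0(1)>0$ and $F_0(-1)>0$. Fix $C>0$ and, for $n$ large enough, let $a,r_a,b,r_b>0$ (depending on $n$) be the solutions of $$F_0(r_a)=a r_a,\qquad F_0(-r_b)=b r_b,\qquad r_a^{1/2}a=r_b^{1/2}b=Cn^{-1/2}.$$ Let $\hat f(0)$ be the monotone least squares estimator at $0$ in the white noise model with noise level $n^{-1/2}$ (defined in the context). Then $$\limsup_{n\to\infty}\ \mathbb{P}\big(\hat f(0)\ge a\big)\le \mathbb{P}\Big(\inf_{s\le 0}\big(W(s)-Cs\big)\le \inf_{0\le s\le 1}\big(W(s)-C(s-\psi_r(s))\big)\Big),$$ $$\limsup_{n\to\infty}\ \mathbb{P}\big(\hat f(0)\le -b\big)\le \mathbb{P}\Big(\inf_{s\le 0}\big(W(s)-Cs\big)\le \inf_{0\le s\le 1}\big(W(s)-C(s-\psi_l(s))\big)\Big),$$ where on the right-hand sides $W$ is a standard two-sided Brownian motion on $\mathbb{R}$.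
   Context: White noise model: one observes $Y(t)=\int_0^t f_0(s)\,ds+n^{-1/2}W(t)$, $t\in[-1,1]$, where $W$ is standard two-sided Brownian motion ($W(0)=0$). Estimator: $\hat F(t)=\sup\{\phi(t):\phi\text{ affine and }\phi(s)\le Y(s)\ \forall s\in[-1,1]\}$ is the greatest convex minorant of $Y$, and $\hat f(t)=\lim_{h\downarrow0}(\hat F(t)-\hat F(t-h))/h$ is its left derivative, $t\in(-1,1)$. The functions $\psi_r,\psi_l$ on $[0,1]$ are $$\psi_r(s)=\limsup_{t\downarrow0}\frac{F_0(st)}{F_0(t)},\qquad \psi_l(s)=\limsup_{t\uparrow0}\frac{F_0(st)}{F_0(t)},$$ with the convention that if $F_0(t)=0$ for some $t>0$ then $\psi_r(s)=0$ for $s\in[0,1)$ and $\psi_r(1)=1$; likewise for $\psi_l$ if $F_0(t)=0$ for some $t<0$. Here $r_a,r_b\in(0,1]$; $F_0$ is convex and nonnegative with $F_0'(0)=0$. *)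

(* Defs.v *)
From HB Require Import structures.
From mathcomp Require Import all_boot all_order all_algebra.
From mathcomp Require Import all_classical all_reals all_analysis.

Set Implicit Arguments.
Unset Strict Implicit.
Unset Printing Implicit Defensive.

Import Order.TTheory GRing.Theory Num.Theory.
Import numFieldNormedType.Exports.

Local Open Scope classical_set_scope.
Local Open Scope ring_scope.

(* The product rule is required for all Borel sets; taking some [A i] to be
   [setT] gives it for subfamilies as well. *)
Definition mutually_independent (R : realType) (d : measure_display)
    (T : measurableType d) (P : probability T R) (k : nat)
    (X : nat -> T -> R) : Prop :=
  forall A : nat -> set R, (forall i, (i < k)%N -> measurable (A i)) ->
    P (\bigcap_(i in `I_k) X i @^-1` A i) =
    (\prod_(i < k) P (X i @^-1` A i))%E.

(* Standard Brownian motion with time set [I], an interval containing 0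
   (two-sided when 0 is interior to [I]): starts at 0, has independent
   centered Gaussian increments of variance the time lag, and continuous paths.
   [normal_prob m s] takes the standard deviation [s]; the values [W t] for
   [t] outside [I] are unconstrained.  All paths, rather than almost all, are
   continuous and vanish at 0: [T] need not be complete for [P], and path events
   could otherwise fail to be measurable. *)
Record brownian_motion (R : realType) (d : measure_display)
    (T : measurableType d) (P : probability T R) (I : set R)
    (W : R -> {RV P >-> R}) : Prop := BrownianMotion {
  bm_start : forall w, W 0 w = 0 ;
  bm_indep : forall (k : nat) (t : nat -> R),
    (forall i, (i <= k)%N -> I (t i)) ->
    (forall i, (i < k)%N -> t i < t i.+1) ->
    mutually_independent P k (fun i w => W (t i.+1) w - W (t i) w) ;
  bm_gauss : forall s t : R, I s -> I t -> s < t ->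
    forall A : set R, measurable A ->
    P ((fun w => W t w - W s w) @^-1` A) =
    normal_prob 0 (Num.sqrt (t - s)) A ;
  bm_cont : forall w, {within I, continuous (fun t => W t w)} }.

Definition primitive0 (R : realType) (f : R -> R) (t : R) : R :=
  if 0 <= t then (\int[lebesgue_measure]_(s in `[0, t]) f s)%R
  else - (\int[lebesgue_measure]_(s in `[t, 0]) f s)%R.

Definition white_noise_obs (R : realType) (F0 : R -> R) (n : nat)
    (path : R -> R) (t : R) : R :=
  F0 t + (Num.sqrt n%:R)^-1 * path t.

Definition gcm (R : realType) (y : R -> R) (t : R) : R :=
  sup [set v : R | exists c e : R,
    (forall s, s \in `[-1, 1] -> c + e * s <= y s) /\ v = c + e * t].

Definition monotone_lse (R : realType) (y : R -> R) (t : R) : R :=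
  lim ((gcm y t - gcm y (t - h)) / h @[h --> 0^'+]).

(* If [F] is convex and nonnegative with [F 0 = 0] as its only zero, the
   ratio lies in [0, 1] for [s] in [0, 1] and [t] near 0, so [fine] does not
   collapse an infinite value. *)
Definition psi_r (R : realType) (F : R -> R) (s : R) : R :=
  if `[< exists2 t, 0 < t <= 1 & F t = 0 >] then (s == 1)%:R
  else fine (limf_esup (fun t => (F (s * t) / F t)%:E) 0^'+).

Definition psi_l (R : realType) (F : R -> R) (s : R) : R :=
  if `[< exists2 t, -1 <= t < 0 & F t = 0 >] then (s == 1)%:R
  else fine (limf_esup (fun t => (F (s * t) / F t)%:E) 0^'-).

(* The infima are taken in the extended reals, since that over the half-line
   may be -oo on a null set. *)
Definition limit_event (R : realType) (C : R) (psi : R -> R) (path : R -> R)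
    : Prop :=
  (ereal_inf [set (path s - C * s)%:E | s in [set s : R | (s <= 0)%R]] <=
   ereal_inf [set (path s - C * (s - psi s))%:E | s in `[0%R, 1%R]])%E.

(* Main.v *)
Require Import Defs.
From HB Require Import structures.
From mathcomp Require Import all_boot all_order all_algebra.
From mathcomp Require Import all_classical all_reals all_analysis.
From mathcomp Require Import measurable_realfun.
From mathcomp Require Import zify ring lra.

Set Implicit Arguments.
Unset Strict Implicit.
Unset Printing Implicit Defensive.

Import Order.TTheory GRing.Theory Num.Theory.
Import numFieldNormedType.Exports.

Local Open Scope classical_set_scope.
Local Open Scope ring_scope.

(** Switching relation. Let Y be continuous on [-1, 1]. The left derivative at 0
    of its greatest convex minorant is at least c if the minimum of Y(s) - c s
    over [-1, 0] is strictly below the one over [0, 1], and at most c otherwise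
    ([left_drop_lse], [lse_left_drop]). Hence, if the estimator is at least a,
    some s in [-1, 0] does at least as well as all u in [0, 1], up to an
    arbitrarily small e, for the function Y(s) - a s ([near_argmin_left]). If
    the estimator is at most -b, the same holds for the data reflected in time,
    so that one limit argument, [limsup_near_argmin], gives both bounds.

    Scaling. Put s = r s' and divide by (r/n)^(1/2). The noise becomes
    X(s') = r^(-1/2) W(r s'), again a Brownian motion; the drift a s becomes
    C s'; and F0(r u) becomes C rho_n(u) with rho_n(u) = F0(r u) / F0(r), by the
    equations that define a and r. On the left F0 >= 0 may be dropped, and on
    the right only u <= 1 is kept. What remains is the comparison of
    the infimum over s <= 0 of X(s) - C s with the infimum over 0 <= u <= 1 of
    X(u) - C (u - rho_n(u)).

    Limit. The process X depends on n through its definition only, not through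
    its law, so it may be replaced by the fixed process W'. Then the reverse
    Fatou lemma applies: an outcome that belongs to infinitely many of the
    events belongs to the limit event, since the upper limit of rho_n(u) is at
    most psi(u) ([psi_r_limsup]).

    Replacing X by W'. The two processes live on different probability spaces
    and only their finite-dimensional laws can be compared. So the comparison of
    infima is first weakened to a comparison over the nodes of a grid of mesh
    1/(k+1) with slack 1/(n+1) ([grid_event]), which is an event about finitely
    many i.i.d. normal increments ([grid_event_law]). For each n the mesh is
    chosen so fine that the change of event costs at most 1/(n+1), and the
    meshes vanish as n grows. To return from nodes to all u in [0, 1], u is
    rounded down: W' is continuous, and rho_n and psi are nondecreasing, so the
    nodes below u do not cost more than u in the limit, even where psi jumps.

    Measurability. Since a measure is unconstrained on non-measurable sets,
    every event above has to be shown measurable; continuity of the paths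
    reduces each of them to countably many grid points. *)

(** * The left derivative of the greatest convex minorant *)

Lemma within_continuous_sub_linear (R : realType) (A : set R) (f : R -> R)
    (c : R) :
  {within A, continuous f} -> {within A, continuous (fun s => f s - c * s)}.
Proof.
move=> cf x; apply: cvgB; first exact: cf.
by apply: continuous_subspaceT => z; apply: cvgM; [exact: cvg_cst|exact: cvg_id].
Qed.

Lemma has_sup_gcm (R : realType) (y : R -> R) (t : R) :
  {within `[-1, 1], continuous y} -> t \in `[-1, 1] ->
  has_sup [set v : R | exists c e : R,
    (forall s, s \in `[-1, 1] -> c + e * s <= y s) /\ v = c + e * t].
Proof.
move=> cy t11; split; last by exists (y t) => _ [c [e [ce ->]]]; exact: ce.
have [|s1 _ ymin] := EVT_min _ cy; first by lra.
exists (y s1), (y s1), 0; split => [s|]; last by rewrite mul0r addr0.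
by rewrite mul0r addr0; exact: ymin.
Qed.

Lemma ge_line_gcm (R : realType) (y : R -> R) (c e t : R) :
  {within `[-1, 1], continuous y} -> t \in `[-1, 1] ->
  (forall s : R, s \in `[-1, 1] -> c + e * s <= y s) -> c + e * t <= gcm y t.
Proof.
move=> cy t11 cey; apply: sup_upper_bound; first exact: has_sup_gcm.
by exists c, e.
Qed.

Lemma gcm_le (R : realType) (y : R -> R) (t : R) :
  {within `[-1, 1], continuous y} -> t \in `[-1, 1] -> gcm y t <= y t.
Proof.
move=> cy t11; apply: sup_le_ub; first by have [] := has_sup_gcm cy t11.
by move=> _ [c [e [ce ->]]]; exact: ce.
Qed.

(** A supremum of affine functions is convex; the three-point form is multiplied
    out so as to cover degenerate triples. *)
Lemma gcm_convex (R : realType) (y : R -> R) (x t z : R) :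
  {within `[-1, 1], continuous y} -> -1 <= x -> x <= t -> t <= z -> z <= 1 ->
  (z - x) * gcm y t <= (z - t) * gcm y x + (t - x) * gcm y z.
Proof.
move=> cy x1 xt tz z1.
have x11 : x \in `[-1, 1] by rewrite in_itv /= x1/=; lra.
have t11 : t \in `[-1, 1] by rewrite in_itv /=; apply/andP; split; lra.
have z11 : z \in `[-1, 1].
  by rewrite in_itv /= z1 andbT (le_trans x1)// (le_trans xt).
have [xz|xz] := eqVneq x z.
  have -> : t = z by lra.
  by rewrite xz subrr !mul0r addr0.
have zx0 : 0 < z - x by rewrite subr_gt0 lt_neqAle xz (le_trans xt).
rewrite -ler_pdivlMl//; apply: sup_le_ub.
  by have [] := has_sup_gcm cy t11.
move=> _ [c [e [ce ->]]]; rewrite ler_pdivlMl//.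
have -> : (z - x) * (c + e * t) =
    (z - t) * (c + e * x) + (t - x) * (c + e * z) by ring.
by apply: lerD; apply: ler_wpM2l; rewrite ?subr_ge0//; apply: ge_line_gcm.
Qed.

(** By convexity the left difference quotients increase as the step decreases,
    and the slope from 0 to 1 bounds them. So the limit in the definition of the
    estimator exists, and is not the arbitrary value of a divergent [lim]. *)
Lemma monotone_lse_sup (R : realType) (y : R -> R) :
  {within `[-1, 1], continuous y} ->
  let q := fun h => (gcm y 0 - gcm y (- h)) / h in
  has_ubound (q @` `]0, 1[) /\ monotone_lse y 0 = sup (q @` `]0, 1[).
Proof.
move=> cy q.
have ubq : has_ubound (q @` `]0, 1[).
  exists (gcm y 1 - gcm y 0) => _ [h /= + <-].
  rewrite in_itv/= => /andP[h0 h1]; rewrite /q ler_pdivrMr//.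
  have := @gcm_convex _ y (- h) 0 1 cy; lra.
split=> //; apply/cvg_lim; first exact: Rhausdorff.
rewrite /monotone_lse; under eq_fun do rewrite sub0r.
apply: nonincreasing_at_right_cvgr => //; first by rewrite bnd_simp.
move=> h' h; rewrite !in_itv/= => /andP[h'0 h'1] /andP[h0 h1] hh.
rewrite /q ler_pdivrMr// mulrAC ler_pdivlMr//.
have := @gcm_convex _ y (- h) (- h') 0 cy; nra.
Qed.

(** The condition of the switching relation at level c. An explicit gap e, rather
    than a strict inequality of infima, makes it testable on countably many
    points. *)
Definition left_drop (R : realType) (y : R -> R) (c : R) : Prop :=
  exists2 s : R, s \in `[-1, 0] & exists2 e : R, 0 < e &
    forall u : R, u \in `[0, 1] -> y s - c * s + e <= y u - c * u.

(** The line of slope c that supports the data touches them at some s1 < 0. The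
    convex minorant meets the line at s1 and is above it at 0, so its left slope
    at 0 is at least c. *)
Lemma left_drop_lse (R : realType) (y : R -> R) (c : R) :
  {within `[-1, 1], continuous y} -> left_drop y c -> c <= monotone_lse y 0.
Proof.
move=> cy [s0 + [e e0 drop]]; rewrite in_itv/= => /andP[s01 s00].
have [ubq ->] := monotone_lse_sup cy.
have [||s1 + ymin] := @EVT_min _ (fun s : R => y s - c * s) (-1) 1; first by lra.
  exact: within_continuous_sub_linear.
rewrite in_itv/= => /andP[s11 s12].
have s1lt0 : s1 < 0.
  rewrite ltNge; apply/negP => s1ge0.
  have := drop s1; rewrite in_itv/= s1ge0 s12 => /(_ isT).
  by have := ymin s0; rewrite in_itv/= s01/= => /(_ ltac:(lra)); lra.
have line t : t \in `[-1, 1] -> (y s1 - c * s1) + c * t <= gcm y t.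
  move=> t11; apply: ge_line_gcm => // s /ymin; lra.
have s1G : gcm y s1 <= y s1 by apply: gcm_le => //; rewrite in_itv/= s11.
have G0 := line 0; rewrite in_itv/= mulr0 addr0 in G0.
move: {G0}(G0 ltac:(lra)) => G0.
have qh h : 0 < h -> h < 1 -> c <= (gcm y 0 - gcm y (- h)) / h ->
    c <= sup ((fun h => (gcm y 0 - gcm y (- h)) / h) @` `]0, 1[).
  move=> h0 h1 /le_trans; apply; apply: ub_le_sup => //.
  by exists h => //=; rewrite in_itv/= h0.
(* The supremum ranges over steps in the open interval ]0, 1[ and s1 may be -1,
   so the slope is taken over half of [s1, 0]. *)
have h0 : 0 < - s1 / 2 by lra.
apply: (qh (- s1 / 2)) => //; first by lra.
rewrite ler_pdivlMr//.
have := @gcm_convex _ y s1 (- (- s1 / 2)) 0 cy; nra.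
Qed.

Lemma Nleft_drop_min (R : realType) (y : R -> R) (c : R) :
  {within `[-1, 1], continuous y} -> ~ left_drop y c ->
  exists2 u : R, u \in `[0, 1] &
    forall s : R, s \in `[-1, 1] -> y u - c * u <= y s - c * s.
Proof.
move=> cy ndrop.
have [||u u01 ymin] := @EVT_min _ (fun s : R => y s - c * s) 0 1; first by lra.
  apply: (@continuous_subspaceW _ _ _ `[(-1 : R), 1]%classic) => [z/=|].
    by rewrite !in_itv/= => /andP[z0 ->]; rewrite andbT; lra.
  exact: within_continuous_sub_linear.
exists u => // s; rewrite in_itv/= => /andP[s1 s2].
have [s0|s0] := leP 0 s; first by apply: ymin; rewrite in_itv/= s0.
rewrite leNgt; apply/negP => lt; apply: ndrop; exists s.
  by rewrite in_itv/= s1 ltW.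
exists ((y u - c * u) - (y s - c * s)); first by lra.
move=> v /ymin; lra.
Qed.

(** Without a drop there is a global minimiser u >= 0 of y s - c s. There the
    minorant meets its supporting line of slope c, while it is above the line at
    - h; convexity on [- h, u] bounds the left difference quotient at 0 by c. *)
Lemma lse_left_drop (R : realType) (y : R -> R) (c : R) :
  {within `[-1, 1], continuous y} -> c < monotone_lse y 0 -> left_drop y c.
Proof.
move=> cy lt; apply: contrapT => /(Nleft_drop_min cy)[u + ymin].
rewrite in_itv/= => /andP[u0 u1]; move: lt; apply/negP; rewrite -leNgt.
have [ubq ->] := monotone_lse_sup cy.
apply: sup_le_ub.
  eexists; exists (1 / 2); last by reflexivity.
  by rewrite /= in_itv/=; apply/andP; split; lra.
move=> _ [h /= + <-]; rewrite in_itv/= => /andP[h0 h1].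
rewrite ler_pdivrMr//.
have line t : t \in `[-1, 1] -> (y u - c * u) + c * t <= gcm y t.
  move=> t11; apply: ge_line_gcm => // s /ymin; lra.
have Gu : gcm y u <= y u by apply: gcm_le => //; rewrite in_itv/= u1 andbT; lra.
have := line (- h); rewrite in_itv/= => /(_ ltac:(lra)) Gh.
have := @gcm_convex _ y (- h) 0 u cy; nra.
Qed.

(** * Grid points and countable descriptions of events *)

(** Rounding down keeps the grid point at most x, so that a nondecreasing function
    does not grow under rounding. *)
Definition grid_floor (R : realType) (k : nat) (x : R) : R :=
  (Num.truncn (k.+1%:R * x))%:R / k.+1%:R.

Lemma grid_floor_le (R : realType) (k : nat) (x : R) :
  0 <= x -> grid_floor k x <= x.
Proof.
move=> x0; rewrite /grid_floor ler_pdivrMr// mulrC.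
by rewrite truncn_le mulr_ge0.
Qed.

Lemma grid_floor_ge0 (R : realType) (k : nat) (x : R) : 0 <= grid_floor k x.
Proof. by rewrite divr_ge0. Qed.

Lemma cvg_grid_floor (R : realType) (x : R) :
  0 <= x -> grid_floor k x @[k --> \oo] --> x.
Proof.
move=> x0.
apply: (@squeeze_cvgr _ _ _ _ (fun k => x - k.+1%:R^-1) (fun=> x)).
- apply: nearW => k; rewrite grid_floor_le// andbT.
  rewrite lerBlDr /grid_floor -[X in _ + X]mul1r -mulrDl ler_pdivlMr//.
  by rewrite mulrC [leRHS]natr1 ltW// truncnS_gt.
- by rewrite -[X in _ --> X]subr0; apply: cvgB; [exact: cvg_cst|exact: cvg_harmonic].
- exact: cvg_cst.
Qed.

Lemma grid_point01 (R : realType) (j k : nat) : (j <= k.+1)%N ->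
  0 <= (j%:R * k.+1%:R^-1 : R) <= 1.
Proof. by move=> jk; rewrite divr_ge0//= ler_pdivrMr// mul1r ler_nat. Qed.

Lemma truncn_grid_le (R : realType) (u : R) (k : nat) :
  0 <= u <= 1 -> (Num.truncn (k.+1%:R * u) <= k.+1)%N.
Proof.
move=> /andP[u0 u1].
by rewrite truncn_le_nat (@le_lt_trans _ _ k.+1%:R) ?ltr_nat// ler_piMr.
Qed.

Lemma cvg_within_seq (R : realType) (A : set R) (f : R -> R) (v : nat -> R)
    (u : R) :
  {within A, continuous f} -> A u -> (forall k, A (v k)) ->
  v k @[k --> \oo] --> u -> f (v k) @[k --> \oo] --> f u.
Proof.
move=> /subspace_continuousP fc Au Av vu.
apply: (@cvg_comp _ _ _ v f _ _ _ _ (fc u Au)).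
move=> B; rewrite /within/= => /vu.
rewrite nbhs_filterE => vB; have : \forall k \near \oo, A (v k) -> B (v k) by [].
by apply: filterS => k; apply.
Qed.

Lemma cvg_eventually_lt (R : realType) (v : nat -> R) (l z : R) :
  v k @[k --> \oo] --> l -> l < z -> exists N, forall k, (N <= k)%N -> v k < z.
Proof. by move=> vl /(cvgr_lt _ vl)[N _ vz]; exists N => k /vz. Qed.

Lemma natSinv_lt (R : realType) (e : R) :
  0 < e -> exists m : nat, m.+1%:R^-1 < e.
Proof.
move=> e0; have [m _ mE] := near_infty_natSinv_lt (PosNum e0).
by exists m; exact: (mE m (leqnn m)).
Qed.

(** The closure properties of measurable sets, stated on predicates so that the
    measurability of an event follows the syntax of its formula. The hypothesis
    under an implication or a conjunction may use the guard b. *)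
Section countable_quantifiers.
Context d (T : measurableType d).
Implicit Types Q : nat -> T -> Prop.

Lemma measurable_exists Q : (forall k, measurable [set w | Q k w]) ->
  measurable [set w | exists k, Q k w].
Proof.
move=> mQ; rewrite (_ : [set w | _] = \bigcup_k [set w | Q k w]).
  exact: bigcupT_measurable.
by apply/seteqP; split=> w [k]; [exists k|exists k].
Qed.

Lemma measurable_forall Q : (forall k, measurable [set w | Q k w]) ->
  measurable [set w | forall k, Q k w].
Proof.
move=> mQ; rewrite (_ : [set w | _] = \bigcap_k [set w | Q k w]).
  exact: bigcapT_measurable.
by apply/seteqP; split=> w /= wQ k; [move=> _|]; exact: wQ.
Qed.

Lemma measurable_imply (b : bool) (A : set T) :
  (b -> measurable A) -> measurable [set w | b -> A w].
Proof.
case: b => [/(_ isT) mA|_].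
  by rewrite (_ : [set w | _] = A)//; apply/seteqP; split=> w //=; exact.
by rewrite (_ : [set w | _] = setT)//; apply/seteqP; split.
Qed.

Lemma measurable_andb (b : bool) (A : set T) :
  (b -> measurable A) -> measurable [set w | b /\ A w].
Proof.
case: b => [/(_ isT) mA|_].
  by rewrite (_ : [set w | _] = A)//; apply/seteqP; split=> w //= [].
by rewrite (_ : [set w | _] = set0)//; apply/seteqP; split=> w // [].
Qed.

Lemma measurable_ler_set (R : realType) (f g : T -> R) :
  measurable_fun setT f -> measurable_fun setT g ->
  measurable [set w | f w <= g w].
Proof.
by move=> mf mg; rewrite -[X in measurable X]setTI; exact: measurable_fun_le.
Qed.

Lemma measurable_ltr_set (R : realType) (f g : T -> R) :
  measurable_fun setT f -> measurable_fun setT g ->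
  measurable [set w | f w < g w].
Proof.
move=> mf mg; rewrite (_ : [set w | _] = ~` [set w | g w <= f w]).
  exact/measurableC/measurable_ler_set.
by apply/seteqP; split=> w /=; rewrite ltNge => /negP.
Qed.

End countable_quantifiers.

(** Moving the left point to the grid costs at most half of the gap, by
    continuity; a bound at all grid points extends to [0, 1] by density. *)
Lemma left_drop_grid (R : realType) (y : R -> R) (c : R) :
  {within `[-1, 1], continuous y} ->
  left_drop y c <-> exists m k i : nat, (i <= k.+1)%N /\
    forall k' j : nat, (j <= k'.+1)%N ->
      y (- (i%:R / k.+1%:R)) - c * - (i%:R / k.+1%:R) + m.+1%:R^-1 <=
      y (j%:R / k'.+1%:R) - c * (j%:R / k'.+1%:R).
Proof.
move=> cy.
have cyc : {within `[-1, 1], continuous (fun s : R => y s - c * s)}.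
  exact: within_continuous_sub_linear.
split=> [[s + [e e0 drop]]|[m [k [i [ik drop]]]]].
  rewrite in_itv/= => /andP[s1 s0].
  have Ns0 : 0 <= - s by lra.
  have Ns1 k : (Num.truncn (k.+1%:R * - s) <= k.+1)%N.
    by apply: truncn_grid_le; lra.
  have : (y (- grid_floor k (- s)) - c * (- grid_floor k (- s))) @[k --> \oo] -->
      y s - c * s.
    apply: (@cvg_within_seq _ _ _ (fun k => - grid_floor k (- s)) _ cyc).
    - by rewrite /= in_itv/=; apply/andP; split; lra.
    - move=> k; rewrite /= in_itv/=.
      by have := grid_floor_ge0 k (- s); have := grid_floor_le k Ns0; lra.
    - by rewrite -[X in _ --> X]opprK; apply: cvgN; exact: cvg_grid_floor.
  move=> /(@cvg_eventually_lt _ _ _ (y s - c * s + e / 2)) /(_ ltac:(lra)).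
  move=> [k /(_ k (leqnn k)) kE].
  have [m mE] := natSinv_lt (ltac:(lra) : 0 < e / 2).
  exists m, k, (Num.truncn (k.+1%:R * - s)); split => // k' j jk'.
  have := drop (j%:R / k'.+1%:R); rewrite in_itv/= (grid_point01 R jk') => /(_ isT).
  move: kE mE; rewrite /grid_floor.
  by move: (m.+1%:R^-1) (- (_ / _)) (j%:R / _) => M S U; lra.
exists (- (i%:R / k.+1%:R)).
  by rewrite in_itv/=; move: (grid_point01 R ik); move: (_ / _) => z; lra.
exists m.+1%:R^-1; first by rewrite invr_gt0.
move=> u; rewrite in_itv/= => /andP[u0 u1].
have : (y (grid_floor k u) - c * (grid_floor k u)) @[k --> \oo] --> y u - c * u.
  apply: (@cvg_within_seq _ _ _ (fun k => grid_floor k u) _ cyc).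
  - by rewrite /= in_itv/=; apply/andP; split; lra.
  - move=> k'; rewrite /= in_itv/=.
    by have := grid_floor_ge0 k' u; have := grid_floor_le k' u0; lra.
  - exact: cvg_grid_floor.
move=> /cvgr_to_ge; apply; apply: nearW => k'; apply: drop.
by apply: truncn_grid_le; rewrite u0.
Qed.

(** The two halves of the switching relation determine the event that the
    estimator is at least c from the drops at the levels below c, and countably
    many such levels suffice. *)
Lemma measurable_monotone_lse d (T : measurableType d) (R : realType)
    (Y : R -> T -> R) :
  (forall t, measurable_fun setT (Y t)) ->
  (forall w, {within `[-1, 1], continuous (Y^~ w)}) ->
  measurable_fun setT (fun w => monotone_lse (Y^~ w) 0).
Proof.
move=> mY cY.
apply: (measurability (@RGenCInfty.G R)).
  exact: RGenCInfty.measurableE.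
move=> /= _ [_] [c] -> <-; rewrite setTI.
rewrite (_ : _ @^-1` _ =
    [set w | forall j : nat, left_drop (Y^~ w) (c - j.+1%:R^-1)]); last first.
  apply/seteqP; split=> w /=; rewrite in_itv/= andbT => cw.
    move=> j; apply: lse_left_drop => //; apply: lt_le_trans cw.
    by rewrite ltrBlDr ltrDl invr_gt0.
  apply/ler_addgt0Pr => e e0.
  have [j jE] := natSinv_lt e0.
  move: (left_drop_lse (cY w) (cw j)) jE.
    by move: (j.+1%:R^-1) (monotone_lse _ _) => z l; lra.
apply: measurable_forall => j.
under eq_set do rewrite (propext (left_drop_grid _ (cY _))).
apply: measurable_exists => m; apply: measurable_exists => k.
apply: measurable_exists => i; apply: measurable_andb => _.
apply: measurable_forall => k'; apply: measurable_forall => l.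
apply: measurable_imply => _; apply: measurable_ler_set.
  by apply: measurable_funD => //; apply: measurable_funB.
exact: measurable_funB.
Qed.

(** The trace of the switching relation at the level c itself, where ties are
    possible and the gap turns into a tolerance. *)
Definition near_argmin_left (R : realType) (y : R -> R) (c : R) : Prop :=
  forall e : R, 0 < e -> exists2 s : R, s \in `[-1, 0] &
    forall u : R, u \in `[0, 1] -> y s - c * s <= y u - c * u + e.

Lemma lse_ge_near_argmin (R : realType) (y : R -> R) (a : R) :
  {within `[-1, 1], continuous y} -> a <= monotone_lse y 0 ->
  near_argmin_left y a.
Proof.
move=> cy ale e e0.
have /(lse_left_drop cy)[s s11 [e' e'0 drop]] : a - e / 2 < monotone_lse y 0.
  by apply: lt_le_trans ale; lra.
exists s => // u u01; have := drop u u01.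
move: s11 u01; rewrite !in_itv/= => /andP[s1 s0] /andP[u0 u1]; nra.
Qed.

(** Here the minimum is on the right of 0 and the level is - b; reflecting time
    brings it to the left, at level b. *)
Lemma lse_le_near_argmin (R : realType) (y : R -> R) (b : R) :
  {within `[-1, 1], continuous y} -> monotone_lse y 0 <= - b ->
  near_argmin_left (fun t => y (- t)) b.
Proof.
move=> cy leb e e0.
have /(Nleft_drop_min cy)[u u01 umin] : ~ left_drop y (- b + e / 2).
  by move=> /(left_drop_lse cy); lra.
exists (- u); first by move: u01; rewrite !in_itv/=; lra.
move=> v; rewrite in_itv/= => /andP[v0 v1].
have := umin (- v); rewrite in_itv/= opprK => /(_ ltac:(lra)).
by move: u01; rewrite in_itv/= => /andP[u0 u1]; nra.
Qed.

(** * The primitive of a nondecreasing function *)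

(** Clamping the argument to [-1, 1] extends f to a nondecreasing function on the
    whole line, hence its measurability; it is bounded by its values at -1
    and 1. *)
Lemma integrable_nondecreasing (R : realType) (f : R -> R) (x z : R) :
  {in `[-1, 1] &, {homo f : x y / x <= y}} -> -1 <= x -> z <= 1 ->
  lebesgue_measure.-integrable `[x, z] (EFin \o f).
Proof.
move=> f_nd x1 z1.
have in11 (t : R) : -1 <= t -> t <= 1 -> t \in `[-1, 1].
  by move=> t1 t2; rewrite in_itv/= t1.
apply: measurable_bounded_integrable => //=.
- by rewrite lebesgue_measure_itv/=; case: ifP => _; rewrite ?ltry.
- pose g t := f (Num.max (-1) (Num.min t 1)).
  have clamp11 t : Num.max (-1) (Num.min t 1) \in `[(-1 : R), 1].
    rewrite in_itv/= le_max lexx/= ge_max; apply/andP; split; first by lra.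
    by rewrite ge_min lexx orbT.
  apply: (eq_measurable_fun g).
    move=> t; rewrite inE/= in_itv/= => /andP[xt tz].
    by rewrite /g min_l ?max_r//; lra.
  apply: nondecreasing_measurable => // s t st; apply: f_nd => //.
  rewrite ge_max le_max lexx/= le_max.
  by rewrite le_min !ge_min st lexx !orbT.
- exists (`|f (-1)| + `|f 1|); split; first by rewrite num_real.
  move=> M ltM t; rewrite /= in_itv/= => /andP[xt tz].
  have t11 : t \in `[-1, 1] by apply: in11; lra.
  have ft1 : f t <= f 1 by apply: f_nd => //; [apply: in11; lra|lra].
  have ft2 : f (-1) <= f t by apply: f_nd => //; [apply: in11; lra|lra].
  have := ler_norm (f 1); have := lerNnormlW (lexx `|f (-1)|).
  have := normr_ge0 (f 1); have := normr_ge0 (f (-1)).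
  rewrite ler_norml; lra.
Qed.

Section primitive_of_nondecreasing.
Context (R : realType) (f : R -> R).
Hypothesis f_nd : {in `[-1, 1] &, {homo f : x y / x <= y}}.
Local Notation mu := (@lebesgue_measure R).

Let in11 (x : R) : -1 <= x -> x <= 1 -> x \in `[-1, 1].
Proof. by move=> x1 x2; rewrite in_itv/= x1. Qed.

Let Rintegral_bounds (x z : R) : -1 <= x -> x <= z -> z <= 1 ->
  f x * (z - x) <= \int[mu]_(t in `[x, z]) f t <= f z * (z - x).
Proof.
move=> x1 xz z1.
have cstE (c : R) : (\int[mu]_(t in `[x, z]) c = c * (z - x))%R.
  rewrite Rintegral_cst//= lebesgue_measure_itv/= lte_fin.
  have [|zx] := ltP x z; first by rewrite -EFinB.
  by rewrite (_ : z = x) ?subrr//; lra.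
have icst (c : R) : mu.-integrable `[x, z] (EFin \o (fun=> c)).
  by apply: integrable_nondecreasing.
rewrite -!cstE; apply/andP; split; apply: le_Rintegral => //;
  rewrite ?(integrable_nondecreasing f_nd)//.
- by move=> t; rewrite /= in_itv/= => /andP[xt tz]; apply: f_nd => //; apply: in11; lra.
- by move=> t; rewrite /= in_itv/= => /andP[xt tz]; apply: f_nd => //; apply: in11; lra.
Qed.

(** Sign, monotonicity and continuity of the primitive all follow from these
    bounds. *)
Lemma primitive0_slope (x z : R) : -1 <= x -> x <= z -> z <= 1 ->
  f x * (z - x) <= primitive0 f z - primitive0 f x <= f z * (z - x).
Proof.
move=> x1 xz z1.
have int := integrable_nondecreasing f_nd.
have [x0|x0] := leP 0 x.
  rewrite /primitive0 x0 (le_trans x0 xz) Rintegral_itvB ?bnd_simp//; last first.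
    by apply: int => //; lra.
  rewrite Rintegral_itv_obnd_cbnd; first exact: Rintegral_bounds.
  by apply: (integrableS _ _ _ (int x z _ _)) => //; apply: subset_itv_oc_cc.
have [z0|z0] := leP 0 z; last first.
  rewrite /primitive0 (lt_geF x0) (lt_geF z0) opprK addrC.
  have := @Rintegral_itvB R f (BLeft x) (BRight 0) z.
  rewrite !bnd_simp (ltW z0) xz => /(_ (int _ _ _ _) isT isT).
  rewrite Rintegral_itv_obnd_cbnd; last first.
    by apply: (integrableS _ _ _ (int z 0 _ _)) => //; [exact: subset_itv_oc_cc|lra].
  move=> /(_ x1 ler01); have := Rintegral_bounds x1 xz z1.
  move: (\int[mu]_(t in `[x, z]) f t) => I; lra.
have := Rintegral_bounds (ltac:(lra) : -1 <= 0) z0 z1.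
have := Rintegral_bounds x1 (ltW x0) ler01.
rewrite /primitive0 z0 (lt_geF x0) !subr0 sub0r opprK.
have : f x <= f 0 by apply: f_nd; rewrite ?in11//; lra.
have : f 0 <= f z by apply: f_nd; rewrite ?in11//; lra.
move: (\int[mu]_(t in `[x, 0]) f t) (\int[mu]_(t in `[0, z]) f t) => I J.
nra.
Qed.
End primitive_of_nondecreasing.

Lemma primitive0_0 (R : realType) (f : R -> R) : primitive0 f 0 = 0.
Proof. by rewrite /primitive0 lexx set_itv1 Rintegral_set1. Qed.

Section primitive_vanishing_at_0.
Context (R : realType) (f : R -> R).
Hypothesis f_nd : {in `[-1, 1] &, {homo f : x y / x <= y}}.
Hypothesis f_0 : f 0 = 0.

Let in11 (x : R) : -1 <= x -> x <= 1 -> x \in `[-1, 1].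
Proof. by move=> x1 x2; rewrite in_itv/= x1. Qed.

Lemma primitive0_ge0 (t : R) : t \in `[-1, 1] -> 0 <= primitive0 f t.
Proof.
rewrite in_itv/= => /andP[t1 t2].
have [t0|t0] := leP 0 t.
  have := primitive0_slope f_nd (ltac:(lra) : -1 <= 0) t0 t2.
  by rewrite f_0 primitive0_0; lra.
have := primitive0_slope f_nd t1 (ltW t0) ler01.
by rewrite f_0 primitive0_0; lra.
Qed.

Lemma primitive0_nd (x z : R) :
  0 <= x -> x <= z -> z <= 1 -> primitive0 f x <= primitive0 f z.
Proof.
move=> x0 xz z1; have := primitive0_slope f_nd (ltac:(lra) : -1 <= x) xz z1.
have : f 0 <= f x by apply: f_nd; rewrite ?in11//; lra.
by rewrite f_0; nra.
Qed.

Lemma primitive0_ni (x z : R) :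
  -1 <= x -> x <= z -> z <= 0 -> primitive0 f z <= primitive0 f x.
Proof.
move=> x1 xz z0; have := primitive0_slope f_nd x1 xz (ltac:(lra) : z <= 1).
have : f z <= f 0 by apply: f_nd; rewrite ?in11//; lra.
by rewrite f_0; nra.
Qed.

Lemma primitive0_cont : {within `[-1, 1], continuous (primitive0 f)}.
Proof.
apply/subspace_continuousP => x /=; rewrite in_itv/= => /andP[x1 x2].
have f1 : 0 <= f 1 by rewrite -f_0; apply: f_nd; rewrite ?in11//; lra.
have f2 : f (-1) <= 0 by rewrite -f_0; apply: f_nd; rewrite ?in11//; lra.
pose K := f 1 - f (-1) + 1.
have K0 : 0 < K by rewrite /K; lra.
have lip (z w : R) : -1 <= z -> z <= w -> w <= 1 ->
    `|primitive0 f z - primitive0 f w| <= K * (w - z).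
  move=> z1 zw w1; have := primitive0_slope f_nd z1 zw w1.
  have : f w <= f 1 by apply: f_nd; rewrite ?in11//; lra.
  have : f (-1) <= f z by apply: f_nd; rewrite ?in11//; lra.
  by rewrite ler_norml /K => ? ? ?; apply/andP; split; nra.
apply/cvgrPdist_le => e e0.
have nb : \forall y \near x, `|x - y| <= e / K.
  have := @cvg_id _ (nbhs x) => /cvgrPdist_le; apply; exact: divr_gt0.
near=> y.
have : y \in `[-1, 1] by near: y; exact: withinT.
rewrite in_itv/= => /andP[y1 y2].
have : `|x - y| <= e / K.
  by near: y; apply: cvg_within; exact: nb.
rewrite ler_pdivlMr// mulrC; apply: le_trans.
have [xy|yx] := leP x y.
  have -> : `|x - y| = y - x by rewrite distrC ger0_norm// subr_ge0.
  exact: lip.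
have -> : `|x - y| = x - y by rewrite ger0_norm// subr_ge0 ltW.
by rewrite distrC; apply: lip => //; exact: ltW.
Unshelve. all: by end_near. Qed.

End primitive_vanishing_at_0.

(** * Scaling of the centred normal law *)

Lemma measurable_mulrl_fun (R : realType) (c : R) :
  measurable_fun [set: R] ( *%R c).
Proof. exact: measurable_funM. Qed.

(** Both sides are measures in A, and they agree on half-open intervals. *)
Lemma lebesgue_measure_scale (R : realType) (c : R) (A : set R) : c != 0 ->
  measurable A ->
  lebesgue_measure A = (`|c|%:E * lebesgue_measure ( *%R c @^-1` A))%E.
Proof.
move=> c0 mA.
pose phi : measurableTypeR R -> measurableTypeR R := *%R c.
have mphi : measurable_fun setT phi by exact: measurable_mulrl_fun.
pose nu : {measure set (measurableTypeR R) -> \bar R} :=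
  mscale (NngNum (normr_ge0 c)) (pushforward lebesgue_measure phi).
have -> : (`|c|%:E * lebesgue_measure ( *%R c @^-1` A))%E = nu mphi A by [].
apply: lebesgue_measure_unique => //= _ [[a b]] _ <-.
rewrite /nu /mscale /= /phi; rewrite /pushforward.
move: c0; rewrite neq_lt => /orP[c0|c0].
  rewrite (_ : _ @^-1` _ = `[b / c, a / c[%classic); last first.
    apply/seteqP; split=> x /=; rewrite !in_itv/=.
      by rewrite ler_ndivrMr// ltr_ndivlMr// mulrC => /andP[-> ->].
    by rewrite ler_ndivrMr// ltr_ndivlMr// mulrC => /andP[-> ->].
  rewrite !lebesgue_measure_itv/= !lte_fin ltr_nM2r ?invr_lt0//.
  case: ifPn => ab; last by rewrite mule0.
  rewrite ltr0_norm// -!EFinB -EFinM; congr (_%:E); field; exact: ltr0_neq0.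
rewrite (_ : _ @^-1` _ = `]a / c, b / c]%classic); last first.
  apply/seteqP; split=> x /=; rewrite !in_itv/=.
    by rewrite ltr_pdivrMr// ler_pdivlMr// mulrC => /andP[-> ->].
  by rewrite ltr_pdivrMr// ler_pdivlMr// mulrC => /andP[-> ->].
rewrite !lebesgue_measure_itv/= !lte_fin ltr_pM2r ?invr_gt0//.
case: ifPn => ab; last by rewrite mule0.
rewrite gtr0_norm// -!EFinB -EFinM; congr (_%:E); field; exact: lt0r_neq0.
Qed.

(** A change of variables in the density. With c of either sign it gives both
    Brownian scaling and the symmetry used for time reversal. *)
Lemma normal_prob_scale (R : realType) (c s : R) (A : set R) :
  c != 0 -> s != 0 -> measurable A ->
  normal_prob 0 s ( *%R c @^-1` A) = normal_prob 0 (`|c| * s) A.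
Proof.
move=> c0 s0 mA; rewrite /normal_prob.
pose phi : measurableTypeR R -> measurableTypeR R := *%R c.
have mphi : measurable_fun setT phi by exact: measurable_mulrl_fun.
pose nu : {measure set (measurableTypeR R) -> \bar R} :=
  mscale (NngNum (normr_ge0 c)) (pushforward lebesgue_measure phi).
have cs0 : `|c| * s != 0 by rewrite mulf_neq0// normr_eq0.
have mpdf t : measurable_fun setT (fun x => (normal_pdf 0 t x)%:E : \bar R).
  by apply/measurable_EFinP; exact: measurable_normal_pdf.
rewrite [RHS](eq_measure_integral (nu mphi)); last first.
  by move=> B mB _; exact: lebesgue_measure_scale.
rewrite ge0_integral_mscale//=; last 2 first.
- exact: (measurable_funTS (mpdf _)).
- by move=> x _; rewrite lee_fin normal_pdf_ge0.
rewrite ge0_integral_pushforward//=; last 2 first.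
- exact: (measurable_funTS (mpdf _)).
- by move=> x _; rewrite lee_fin normal_pdf_ge0.
have mpre : measurable (phi @^-1` A) by rewrite -[X in measurable X]setTI; exact: mphi.
rewrite -ge0_integralZl//=; last 2 first.
- exact: (measurable_funTS (measurableT_comp (mpdf _) mphi)).
- by move=> x _; rewrite lee_fin normal_pdf_ge0.
apply: eq_integral => x _; rewrite -EFinM; congr (_%:E).
rewrite !normal_pdfE// /normal_peak /normal_fun !subr0 mulrA; congr (_ * _).
  have -> : (`|c| * s) ^+ 2 * pi *+ 2 = `|c| ^+ 2 * (s ^+ 2 * pi *+ 2) by ring.
  rewrite sqrtrM ?sqr_ge0// sqrtr_sqr normr_id invfM mulrA divff ?mul1r//.
  by rewrite normr_eq0.
congr expR; rewrite /phi !exprMn real_normK ?num_real//; field.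
by rewrite c0 s0.
Qed.

(** * The law of finitely many random variables *)

Section law_of_finite_sequences.
Context (R : realType) (K : nat).

(** Boxes in the first K coordinates. Infinite sequences serve as a fixed carrier
    for all K: the coordinates from K on are invisible to the sigma-algebra that
    the boxes generate. *)
Definition rectangle : set (set (nat -> R)) :=
  [set E | exists2 B : nat -> set R, (forall i, (i < K)%N -> measurable (B i)) &
    E = \bigcap_(i in `I_K) (fun x => x i) @^-1` B i].

Local Notation seqspace := (g_sigma_algebraType rectangle).

Lemma measurable_coord (i : nat) : (i < K)%N ->
  measurable_fun [set: seqspace] (fun x : seqspace => x i).
Proof.
move=> iK _ B mB; rewrite setTI; apply: sub_sigma_algebra.
exists (fun j => if j == i then B else setT).
  by move=> j _; case: ifP.
apply/seteqP; split=> x /=; first by move=> Bx j _ /=; case: eqP => // ->.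
by move=> /(_ i iK)/=; rewrite eqxx.
Qed.

Lemma measurable_seqspace d (T : measurableType d) (xi : nat -> T -> R) :
  (forall i, (i < K)%N -> measurable_fun setT (xi i)) ->
  measurable_fun setT ((fun w i => xi i w) : T -> seqspace).
Proof.
move=> mxi.
apply: (@measurability _ _ T seqspace setT (fun w i => xi i w) rectangle) => //.
move=> _ [_ [B mB ->] <-].
rewrite setTI preimage_bigcap; apply: bigcap_measurableType => i iK.
by rewrite -[X in measurable X]setTI; apply: mxi => //; exact: mB.
Qed.

(** Boxes are stable under intersection, so two laws that agree on them agree on
    the sigma-algebra they generate. *)
Lemma law_unique d (T : measurableType d) (P : probability T R)
    d' (T' : measurableType d') (P' : probability T' R)
    (xi : nat -> T -> R) (xi' : nat -> T' -> R) :
  (forall i, (i < K)%N -> measurable_fun setT (xi i)) ->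
  (forall i, (i < K)%N -> measurable_fun setT (xi' i)) ->
  (forall B : nat -> set R, (forall i, (i < K)%N -> measurable (B i)) ->
    P (\bigcap_(i in `I_K) xi i @^-1` B i) =
    P' (\bigcap_(i in `I_K) xi' i @^-1` B i)) ->
  forall E : set seqspace, measurable E ->
    P [set w | E (fun i => xi i w)] = P' [set w | E (fun i => xi' i w)].
Proof.
move=> /measurable_seqspace mxi /measurable_seqspace mxi' PP' E mE.
pose mu : measure seqspace R :=
  pushforward P ((fun w i => xi i w) : T -> seqspace).
pose mu' : measure seqspace R :=
  pushforward P' ((fun w i => xi' i w) : T' -> seqspace).
suff : mu mxi E = mu' mxi' E by [].
apply: (@measure_unique _ R seqspace rectangle (fun=> setT) erefl _ _ _
  (mu mxi) (mu' mxi')) => //.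
- move=> _ _ [B mB ->] [B' mB' ->]; exists (fun i => B i `&` B' i).
    by move=> i iK; apply: measurableI; [exact: mB|exact: mB'].
  by rewrite -bigcapI.
- by move=> i; exists (fun=> setT) => //; apply/seteqP; split.
- by rewrite bigcup_const.
- by move=> _ [B mB ->]; rewrite /mu /mu'/= /pushforward !preimage_bigcap; exact: PP'.
- by move=> k; rewrite /mu/= /pushforward preimage_setT probability_setT ltry.
Qed.

End law_of_finite_sequences.

(** * Brownian motion on a grid *)

(** Reflection reverses the order of the increments and changes their signs; the
    product rule does not see the order, nor the normal law the sign. *)
Lemma brownian_motion_reflect (R : realType) d (T : measurableType d)
    (P : probability T R) (I : set R) (W : R -> {RV P >-> R}) :
  brownian_motion I W ->
  brownian_motion [set t | I (- t)] (fun t => W (- t)).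
Proof.
case=> W0 indep gauss cont; split.
- by move=> w; rewrite oppr0.
- move=> k t It t_lt A mA.
  pose t' j := - t (k - j)%N.
  have It' j : (j <= k)%N -> I (t' j) by move=> jk; apply: It; exact: leq_subr.
  have t'_lt j : (j < k)%N -> t' j < t' j.+1.
    move=> jk; rewrite /t' ltrN2 (_ : (k - j = (k - j.+1).+1)%N); last by lia.
    by apply: t_lt; lia.
  pose A' j := *%R (-1) @^-1` A (k.-1 - j)%N.
  have rev_lt j : (j < k)%N -> (k.-1 - j < k)%N.
    by move=> jk; lia.
  have mA' j : (j < k)%N -> measurable (A' j).
    move=> jk; rewrite -[X in measurable X]setTI; apply: measurable_mulrl_fun => //.
    by apply: mA; exact: rev_lt.
  have preE j : (j < k)%N ->
      (fun w => W (t' j.+1) w - W (t' j) w) @^-1` A' j =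
      (fun w => W (- t (k.-1 - j).+1) w - W (- t (k.-1 - j)%N) w)
        @^-1` A (k.-1 - j)%N.
    move=> jk; have e1 : (k - j = (k.-1 - j).+1)%N by lia.
    have e2 : (k - j.+1 = k.-1 - j)%N by lia.
    by rewrite /t' e1 e2; apply/seteqP; split=> w /=; rewrite /A'/= mulN1r opprB.
  have -> : \bigcap_(i in `I_k) (fun w => W (- t i.+1) w - W (- t i) w) @^-1` A i =
      \bigcap_(i in `I_k) (fun w => W (t' i.+1) w - W (t' i) w) @^-1` A' i.
    apply/seteqP; split=> w Aw i /= ik.
      by have := Aw _ (rev_lt _ ik); rewrite -[X in X -> _]/(_ w) -preE.
    have := Aw _ (rev_lt _ ik); rewrite -[X in X -> _]/(_ w) preE ?rev_lt//.
    by have -> : (k.-1 - (k.-1 - i) = i)%N by lia.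
  rewrite (indep k t' It' t'_lt A' mA') (reindex_inj rev_ord_inj)/=.
  apply: eq_bigr => i _; rewrite preE ?rev_lt//.
    have -> : (k.-1 - (k - i.+1) = i)%N by have := ltn_ord i; lia.
    by [].
  by have := ltn_ord i; lia.
- move=> s t Is It st A mA.
  have -> : (fun w => W (- t) w - W (- s) w) @^-1` A =
      (fun w => W (- s) w - W (- t) w) @^-1` ( *%R (-1) @^-1` A).
    by apply/seteqP; split=> w /=; rewrite mulN1r opprB.
  have mA' : measurable ( *%R (-1) @^-1` A).
    by rewrite -[X in measurable X]setTI; exact: measurable_mulrl_fun.
  have tsN : - t < - s by rewrite ltrN2.
  have s0 : Num.sqrt (t - s) != 0 by rewrite gt_eqF// sqrtr_gt0; lra.
  have N10 : (-1 : R) != 0 by lra.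
  rewrite (gauss (- t) (- s) It Is tsN _ mA') (_ : - s - - t = t - s); last by ring.
  have := normal_prob_scale N10 s0 mA.
  by rewrite normrN1 mul1r.
- move=> w; apply/subspace_continuousP => x /= Ix.
  have /subspace_continuousP /(_ (- x) Ix) Wx := cont w.
  apply: (@cvg_comp _ _ _ -%R (fun t => W t w) _ _ _ _ Wx).
  have oppx : - y @[y --> x] --> - x by apply: cvgN; exact: cvg_id.
  move=> B; rewrite /within/= => /oppx.
  rewrite nbhs_filterE => xB.
  by have : \forall y \near x, I (- y) -> B (- y) by exact: xB.
Qed.

Section grid.
Context (R : realType) (N K : nat) (h : R).

(** The nodes are (i - N) h for 0 <= i <= K, so node N is the origin. The
    independence and normality of the increments between them is all that is
    used of the law of a Brownian motion. *)
Definition normal_grid d (T : measurableType d) (P : probability T R)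
    (X : R -> T -> R) : Prop :=
  forall B : nat -> set R, (forall i, (i < K)%N -> measurable (B i)) ->
    P (\bigcap_(i in `I_K)
         (fun w => X ((i.+1%:R - N%:R) * h) w - X ((i%:R - N%:R) * h) w)
           @^-1` B i) =
    (\prod_(i < K) normal_prob 0 (Num.sqrt h) (B i))%E.

(** Brownian scaling: the factor 1 / sqrt r compensates for the lag r h that the
    change of time produces. *)
Lemma brownian_motion_grid d (T : measurableType d) (P : probability T R)
    (I : set R) (W : R -> {RV P >-> R}) (r : R) :
  brownian_motion I W -> 0 < h -> 0 < r ->
  (forall i, (i <= K)%N -> I (r * ((i%:R - N%:R) * h))) ->
  normal_grid P (fun t w => (Num.sqrt r)^-1 * W (r * t) w).
Proof.
move=> bW h0 r0 It B mB.
pose t i := r * ((i%:R - N%:R) * h).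
have dt i : t i.+1 - t i = r * h by rewrite /t -natr1; ring.
have t_lt i : (i < K)%N -> t i < t i.+1.
  by move=> _; rewrite -subr_gt0 dt mulr_gt0.
pose c := (Num.sqrt r)^-1.
have c0 : 0 < c by rewrite invr_gt0 sqrtr_gt0.
pose B' i := *%R c @^-1` B i.
have mB' i : (i < K)%N -> measurable (B' i).
  move=> iK; rewrite -[X in measurable X]setTI.
  by apply: measurable_mulrl_fun => //; exact: mB.
have preE i : (fun w => c * W (t i.+1) w - c * W (t i) w) @^-1` B i =
    (fun w => W (t i.+1) w - W (t i) w) @^-1` B' i.
  by apply/seteqP; split=> w /=; rewrite /B'/= mulrBr.
under eq_bigcapr do rewrite preE.
rewrite (bm_indep bW It t_lt mB'); apply: eq_bigr => i _.
have Ii : I (t i) by exact: It (ltnW (ltn_ord i)).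
have Ii1 : I (t i.+1) by exact: It (ltn_ord i).
have srh0 : Num.sqrt (r * h) != 0 by rewrite gt_eqF// sqrtr_gt0 mulr_gt0.
rewrite (bm_gauss bW Ii Ii1 (t_lt i (ltn_ord i)) (mB' i (ltn_ord i))) dt.
have csrh : `|c| * Num.sqrt (r * h) = Num.sqrt h.
  by rewrite gtr0_norm// sqrtrM 1?ltW// mulKf// gt_eqF// sqrtr_gt0.
have := normal_prob_scale (lt0r_neq0 c0) srh0 (mB i (ltn_ord i)).
rewrite csrh; exact: id.
Qed.

End grid.

Section grid_event.
Context (R : realType) (N k : nat) (h : R) (alpha beta : nat -> R).

(** The comparison of the two infima restricted to nodes: one node on the left
    beats all nodes on the right. The penalties alpha and beta are deterministic
    and contain the drift and the slack. *)
Definition grid_event (X : R -> R) : Prop :=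
  exists i : nat, (i <= N)%N /\ forall j : nat, (j <= k)%N ->
    X (- (i%:R * h)) + alpha i < X (j%:R * h) + beta j.

Lemma measurable_grid_event d (T : measurableType d) (X : R -> T -> R) :
  (forall t, measurable_fun setT (X t)) ->
  measurable [set w | grid_event (X^~ w)].
Proof.
move=> mX; apply: measurable_exists => i; apply: measurable_andb => _.
apply: measurable_forall => j; apply: measurable_imply => _.
by apply: measurable_ltr_set; apply: measurable_funD.
Qed.

(** Both sides of each inequality may be measured from the leftmost node, and
    then they are partial sums of the increments: the event is a function of the
    increments alone, whose law is known. *)
Lemma grid_event_law d (T : measurableType d) (P : probability T R)
    d' (T' : measurableType d') (P' : probability T' R)
    (X : R -> T -> R) (X' : R -> T' -> R) :
  (forall t, measurable_fun setT (X t)) ->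
  (forall t, measurable_fun setT (X' t)) ->
  normal_grid N (N + k) h P X -> normal_grid N (N + k) h P' X' ->
  P [set w | grid_event (X^~ w)] = P' [set w | grid_event (X'^~ w)].
Proof.
move=> mX mX' gX gX'.
pose S l (x : nat -> R) := \sum_(0 <= m < l) x m.
pose inc U (Y : R -> U -> R) i w :=
  Y ((i.+1%:R - N%:R) * h) w - Y ((i%:R - N%:R) * h) w.
pose E (x : nat -> R) := exists i : nat, (i <= N)%N /\
  forall j : nat, (j <= k)%N ->
    S (N - i)%N x + alpha i < S (N + j)%N x + beta j.
have EX U (Y : R -> U -> R) : [set w | grid_event (Y^~ w)] =
    [set w | E (fun i => inc _ Y i w)].
  have SE l w : S l (fun i => inc _ Y i w) =
      Y ((l%:R - N%:R) * h) w - Y ((0%:R - N%:R) * h) w.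
    rewrite /S /inc (telescope_sumr_eq (fun i => Y ((i%:R - N%:R) * h) w))//.
  apply/funext => w; apply/propext; rewrite /grid_event /E/=.
  have SE1 i : (i <= N)%N ->
      S (N - i)%N (inc _ Y ^~ w) = Y (- (i%:R * h)) w - Y ((0%:R - N%:R) * h) w.
    by move=> iN; rewrite SE natrB//; congr (Y _ _ - _); ring.
  have SE2 j :
      S (N + j)%N (inc _ Y ^~ w) = Y (j%:R * h) w - Y ((0%:R - N%:R) * h) w.
    by rewrite SE natrD; congr (Y _ _ - _); ring.
  split=> -[i [iN ij]]; exists i; split=> // j /ij.
    by rewrite SE1// SE2; lra.
  by rewrite SE1// SE2; lra.
rewrite !EX; apply: (@law_unique R (N + k)) => //.
- by move=> i _; exact: measurable_funB.
- by move=> i _; exact: measurable_funB.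
- by move=> B mB; rewrite gX// gX'.
have mS l : (l <= N + k)%N ->
    measurable_fun [set: g_sigma_algebraType (@rectangle R (N + k))] (S l).
  move=> lK; apply: (eq_measurable_fun
    (fun x : g_sigma_algebraType (@rectangle R (N + k)) => \sum_(m < l) x m)).
    by move=> x _; rewrite /S big_mkord.
  apply: measurable_sum => i; apply: measurable_coord.
  exact: leq_trans (ltn_ord i) lK.
apply: measurable_exists => i; apply: measurable_andb => iN.
apply: measurable_forall => j; apply: measurable_imply => jk.
apply: measurable_ltr_set; apply: measurable_funD => //; apply: mS.
  by rewrite (leq_trans (leq_subr _ _))// leq_addr.
by rewrite leq_add2l.
Qed.

End grid_event.

(** * The limit event *)

(** With a tolerance and a witness on the left no infimum is left, in particular
    none that could be -oo. *)
Lemma limit_event_lt (R : realType) (C : R) (psi p : R -> R) :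
  limit_event C psi p <->
  forall u e : R, 0 <= u <= 1 -> 0 < e -> exists2 s : R, s <= 0 &
    p s - C * s < p u - C * (u - psi u) + e.
Proof.
split=> [le_inf u e u01 e0|lt_inf].
  have : (ereal_inf [set (p s - C * s)%:E | s in [set s : R | (s <= 0)%R]] <
          (p u - C * (u - psi u) + e)%:E)%E.
    apply: (le_lt_trans le_inf).
    apply: (@le_lt_trans _ _ (p u - C * (u - psi u))%:E).
      by apply: ereal_inf_lbound; exists u => //=; rewrite in_itv.
    by rewrite lte_fin ltrDl.
  by move=> /ereal_inf_lt[_ [s /= s0 <-]]; rewrite lte_fin; exists s.
apply: le_ereal_inf_tmp => _ [u /= + <-]; rewrite in_itv/= => u01.
apply/lee_addgt0Pr => e e0; have [s s0 ps] := lt_inf u e u01 e0.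
apply: (@le_trans _ _ (p s - C * s)%:E).
  by apply: ereal_inf_lbound; exists s.
by rewrite -EFinD lee_fin ltW.
Qed.

(** The point s on the left moves to the grid by continuity of the path. On the
    right u is rounded down, because psi is monotone but may jump at 1. *)
Lemma limit_event_grid (R : realType) (C : R) (psi p : R -> R) : 0 < C ->
  {within [set: R], continuous p} ->
  (forall u v : R, 0 <= u -> u <= v -> v <= 1 -> psi u <= psi v) ->
  limit_event C psi p <-> forall k j m : nat, (j <= k.+1)%N ->
    exists k' i : nat,
      p (- (i%:R * k'.+1%:R^-1)) - C * - (i%:R * k'.+1%:R^-1) <
      p (j%:R * k.+1%:R^-1) -
        C * (j%:R * k.+1%:R^-1 - psi (j%:R * k.+1%:R^-1)) + m.+1%:R^-1.
Proof.
move=> C0 cp psi_nd.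
have cpC : {within [set: R], continuous (fun s : R => p s - C * s)}.
  exact: within_continuous_sub_linear.
apply: (iff_trans (limit_event_lt _ _ _)); split=> [lt k j m jk|lt u e u01 e0].
  have [|s s0] := lt _ m.+1%:R^-1 (grid_point01 R jk); first by rewrite invr_gt0.
  have Ns0 : 0 <= - s by lra.
  have := @cvg_within_seq _ _ _ (fun k => - grid_floor k (- s)) s cpC I (fun=> I).
  move=> /(_ _)/cvg_eventually_lt cs /cs[|k' /(_ k' (leqnn k')) sk'].
    by rewrite -[X in _ --> X]opprK; apply: cvgN; exact: cvg_grid_floor.
  by exists k', (Num.truncn (k'.+1%:R * - s)).
have /andP[u0 u1] := u01.
have := @cvg_within_seq _ _ _ (fun k => grid_floor k u) u cpC I (fun=> I).
move=> /(_ (cvg_grid_floor u0)).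
move=> /(@cvg_eventually_lt _ _ _ (p u - C * u + e / 2)) /(_ ltac:(lra)).
move=> [k /(_ k (leqnn k)) ku].
have [m me] := natSinv_lt (ltac:(lra) : 0 < e / 2).
have [k' [i lti]] := lt k _ m (truncn_grid_le k u01).
exists (- (i%:R * k'.+1%:R^-1)); first by rewrite oppr_le0 divr_ge0.
have := psi_nd _ _ (grid_floor_ge0 k u) (grid_floor_le k u0) u1.
move: lti ku me; rewrite -/(grid_floor k u).
move: (- (_ * _)) (m.+1%:R^-1) (grid_floor k u) => s z v; nra.
Qed.

Lemma measurable_limit_event (R : realType) d (T : measurableType d)
    (C : R) (psi : R -> R) (X : R -> T -> R) : 0 < C ->
  (forall t, measurable_fun setT (X t)) ->
  (forall w, {within [set: R], continuous (X^~ w)}) ->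
  (forall u v : R, 0 <= u -> u <= v -> v <= 1 -> psi u <= psi v) ->
  measurable [set w | limit_event C psi (X^~ w)].
Proof.
move=> C0 mX cX psi_nd.
under eq_set do rewrite (propext (limit_event_grid C0 (cX _) psi_nd)).
apply: measurable_forall => k; apply: measurable_forall => j.
apply: measurable_forall => m; apply: measurable_imply => _.
apply: measurable_exists => k'; apply: measurable_exists => i.
apply: measurable_ltr_set; first exact: measurable_funB.
by apply: measurable_funD => //; exact: measurable_funB.
Qed.

(** * From the data to grid events and to the limit event *)

(** The scaling step. With q = sqrt r, dividing by kappa q sends the drift a s to
    C (s / r) and F (r u) to C (F (r u) / F r), because C = q a / kappa and
    F r = a q^2. The term F s0 on the left is nonnegative and is dropped. Half of
    the slack e pays for the tolerance of the approximate minimiser and half for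
    moving it to the grid; the left part of the grid covers [- 1 / r, 0] up to
    one mesh. *)
Lemma near_argmin_grid (R : realType) (F p : R -> R) (kappa a r C e : R) :
  {within `[-1, 1], continuous p} ->
  (forall t : R, t \in `[-1, 0] -> 0 <= F t) ->
  0 < kappa -> 0 < a -> 0 < r <= 1 ->
  F r = a * r -> Num.sqrt r * a = C * kappa ->
  near_argmin_left (fun t => F t + kappa * p t) a -> 0 < e ->
  exists k0, forall k, (k0 <= k)%N ->
    grid_event (Num.truncn (k.+1%:R / r)) k.+1 k.+1%:R^-1
      (fun i => C * (i%:R * k.+1%:R^-1))
      (fun j => - (C * (j%:R * k.+1%:R^-1 - F (r * (j%:R * k.+1%:R^-1)) / F r)) + e)
      (fun t => (Num.sqrt r)^-1 * p (r * t)).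
Proof.
move=> cp F0 kappa0 a0 /andP[r0 r1] Fr ra argmin e0.
pose q := Num.sqrt r; have q0 : 0 < q by rewrite sqrtr_gt0.
have rE : r = q ^+ 2 by rewrite sqr_sqrtr// ltW.
have CE : C = q * a / kappa by rewrite ra mulfK// gt_eqF.
have C0 : 0 < C by rewrite CE divr_gt0// mulr_gt0.
have ekq : 0 < e / 2 * (kappa * q) by rewrite mulr_gt0 ?divr_gt0// mulr_gt0.
have [s0 + argmin_s0] := argmin _ ekq; rewrite in_itv/= => /andP[s01 s00].
pose s := s0 / r; have rs : r * s = s0 by rewrite /s mulrCA divff ?mulr1// gt_eqF.
have s_le0 : 0 <= - s by rewrite /s -mulNr divr_ge0 ?oppr_ge0// ltW.
have Ns_le : - s <= r^-1 by rewrite /s -mulNr ler_piMl ?invr_ge0 ?(ltW r0)//; lra.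
have /(@cvg_eventually_lt _ _ _ (q^-1 * p (r * s) - C * s + e / 2)) :
    q^-1 * p (r * - grid_floor k (- s)) - C * (- grid_floor k (- s)) @[k --> \oo]
    --> q^-1 * p (r * s) - C * s.
  have gs : - grid_floor k (- s) @[k --> \oo] --> s.
    by rewrite -[X in _ --> X]opprK; apply: cvgN; exact: cvg_grid_floor.
  apply: cvgB; last by apply: cvgM => //; exact: cvg_cst.
  apply: cvgM; first exact: cvg_cst.
  apply: (cvg_within_seq (v := fun k => r * - grid_floor k (- s)) cp).
  - by rewrite rs /= in_itv/=; apply/andP; split; lra.
  - move=> k; rewrite /= in_itv/=.
    have g0 := grid_floor_ge0 k (- s); have gle := grid_floor_le k s_le0.
    have : r * grid_floor k (- s) <= 1.
      by rewrite mulrC -ler_pdivlMr// mul1r (le_trans gle).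
    have : 0 <= r * grid_floor k (- s) by rewrite mulr_ge0// ltW.
    by rewrite mulrN; lra.
  - by apply: cvgM => //; exact: cvg_cst.
move=> /(_ ltac:(lra))[k0 near_s]; exists k0 => k /near_s sk.
exists (Num.truncn (k.+1%:R * - s)); split.
  by apply: le_truncn; rewrite ler_wpM2l.
move=> j /(grid_point01 R); move: (j%:R * _) => u /andP[u0 u1].
apply: (@lt_le_trans _ _ (q^-1 * p (r * s) - C * s + e / 2)).
  by move: sk; rewrite /grid_floor [C * - _]mulrN opprK.
have ru01 : r * u \in `[0, 1] by rewrite in_itv/= mulr_ge0 ?mulr_ile1// ltW.
have := argmin_s0 _ ru01.
have : 0 <= F s0 by apply: F0; rewrite in_itv/= s01.
rewrite -/q rs Fr /s CE rE.
move: (p s0) (p (q ^+ 2 * u)) (F s0) (F (q ^+ 2 * u)) => ps pu Fs Fu Fs0 le.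
rewrite -(ler_pM2l (mulr_gt0 kappa0 q0)).
have -> : kappa * q * (q^-1 * ps - q * a / kappa * (s0 / q ^+ 2) + e / 2) =
    kappa * ps - a * s0 + e / 2 * (kappa * q).
  by field; rewrite !gt_eqF.
have -> : kappa * q * (q^-1 * pu +
    (- (q * a / kappa * (u - Fu / (a * q ^+ 2))) + e)) =
    Fu + kappa * pu - a * (q ^+ 2 * u) + e / 2 * (kappa * q) + e / 2 * (kappa * q).
  by field; rewrite !gt_eqF.
lra.
Qed.

(** The reverse Fatou lemma for events, with a vanishing error. *)
Lemma limn_esup_le_lim_sup_set (R : realType) d (T : measurableType d)
    (P : probability T R) (x : nat -> \bar R) (E : nat -> set T) :
  (forall n, measurable (E n)) ->
  (forall n, (x n <= P (E n) + (n.+1%:R^-1)%:E)%E) ->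
  (limn_esup x <= P (lim_sup_set E))%E.
Proof.
move=> mE xE.
have fatou : (P (\bigcup_(k >= n) E k) + (n.+1%:R^-1)%:E)%E @[n --> \oo] -->
    (P (lim_sup_set E) + 0%:E)%E.
  apply: cvgeD.
  - by rewrite fin_num_adde_defl.
  - apply: lim_sup_set_cvg => //.
    rewrite (le_lt_trans (probability_le1 _ _))// ?ltry//.
    exact: bigcup_measurable.
  - by apply: cvg_EFin; [exact: nearW|exact: cvg_harmonic].
rewrite -[leRHS]adde0 -(cvg_lim _ fatou)//; apply: lime_ge.
  by apply/cvg_ex; eexists; exact: fatou.
apply: nearW => n.
apply: (@le_trans _ _ (ereal_sup [set x m | m in [set m | (n <= m)%N]])).
  apply: ereal_inf_lbound; exists [set m | (n <= m)%N] => //=.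
  by exists n.
apply: ub_ereal_sup => _ [m /= nm <-]; apply: (le_trans (xE m)); apply: leeD.
  apply: le_measure; rewrite ?inE//; first exact: bigcup_measurable.
  by move=> w Ew; exists m.
by rewrite lee_fin lef_pV2 ?posrE// ler_nat.
Qed.

(** The set A is contained in the lower limit of the sets G k, the increasing
    union of the intersections B k; continuity from below provides k. *)
Lemma probability_le_grid (R : realType) d (T : measurableType d)
    (P : probability T R) (A : set T) (G : nat -> set T) (n : nat) (e : R) :
  measurable A -> (forall k, measurable (G k)) -> 0 < e ->
  (forall w, A w -> exists k0, forall k, (k0 <= k)%N -> G k w) ->
  exists2 k, (n <= k)%N & (P A <= P (G k) + e%:E)%E.
Proof.
move=> mA mG e0 AG.
pose B k := \bigcap_(j in [set j | (k <= j)%N]) G j.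
have mB k : measurable (B k) by apply: bigcap_measurableType => j _.
have ndB : nondecreasing_seq B.
  move=> i j ij; apply/subsetPset => w Bw l /= jl; apply: Bw => /=.
  exact: leq_trans jl.
have cvB : P (B k) @[k --> \oo] --> P (\bigcup_k B k).
  by apply: nondecreasing_cvg_mu => //; exact: bigcupT_measurable.
have [k0 [nk0 le]] : exists k, (n <= k)%N /\
    (P (\bigcup_k B k) <= P (B k) + e%:E)%E.
  apply: contrapT => nle.
  have : (P (\bigcup_k B k) + e%:E <= P (\bigcup_k B k))%E.
    rewrite -leeBrDr//.
    rewrite -[leLHS](cvg_lim _ cvB)//; apply: lime_le.
      by apply/cvg_ex; eexists; exact: cvB.
    near=> k; rewrite leNgt; apply/negP => lt; apply: nle; exists k; split.
      by near: k; exists n.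
    by rewrite -leeBlDr// ltW.
  have fin : (P (\bigcup_k B k)) \is a fin_num.
    by apply: fin_num_measure; exact: bigcupT_measurable.
  by rewrite -(fineK fin) -EFinD lee_fin; lra.
exists k0 => //; apply: (le_trans _ (le_trans le _)).
  apply: le_measure; rewrite ?inE//; first exact: bigcupT_measurable.
  by move=> w /AG[k Gk]; exists k => // j; exact: Gk.
apply: leeD2r; apply: le_measure; rewrite ?inE//.
by move=> w; apply => /=.
Unshelve. all: by end_near. Qed.

(** Fix u in [0, 1]. In each of infinitely many grid events the winning left node
    beats the node just below u. As n grows, this node tends to u, its ratio is
    at most the one at u by monotonicity of F, hence eventually at most psi u up
    to a small error, and the slack 1 / (n + 1) vanishes: the left node is the
    witness s required in the limit event. *)
Lemma grid_event_limit (R : realType) (F psi p : R -> R) (C : R)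
    (r : nat -> R) (kk NN : nat -> nat) : 0 < C ->
  {within [set: R], continuous p} ->
  (forall x y : R, 0 <= x -> x <= y -> y <= 1 -> F x <= F y) ->
  (\forall n \near \oo, [/\ 0 < r n <= 1, 0 < F (r n) & (n <= kk n)%N]) ->
  (forall u e : R, 0 <= u <= 1 -> 0 < e ->
    \forall n \near \oo, F (r n * u) / F (r n) <= psi u + e) ->
  (forall m, exists2 n, (m <= n)%N &
    grid_event (NN n) (kk n).+1 (kk n).+1%:R^-1
      (fun i => C * (i%:R * (kk n).+1%:R^-1))
      (fun j => - (C * (j%:R * (kk n).+1%:R^-1 -
         F (r n * (j%:R * (kk n).+1%:R^-1)) / F (r n))) + n.+1%:R^-1) p) ->
  limit_event C psi p.
Proof.
move=> C0 cp F_nd rP ratioP io; apply/limit_event_lt => u e u01 e0.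
have /andP[u0 u1] := u01.
have cpC : {within [set: R], continuous (fun s : R => p s - C * s)}.
  exact: within_continuous_sub_linear.
have := @cvg_within_seq _ _ _ (fun k => grid_floor k u) u cpC I (fun=> I).
move=> /(_ (cvg_grid_floor u0)).
move=> /(@cvg_eventually_lt _ _ _ (p u - C * u + e / 3)) /(_ ltac:(lra)).
move=> [k0 ku].
have e3 : 0 < e / 3 / C by rewrite !divr_gt0.
have [n0 _ ratio_n] := ratioP u _ u01 e3.
have [n1 _ r_n] := rP.
have [n2 _ inv_n] := near_infty_natSinv_lt (PosNum (ltac:(lra) : 0 < e / 3)).
have [n] := io (maxn (maxn k0 n0) (maxn n1 n2)).
rewrite !geq_max => /andP[/andP[k0n n0n] /andP[n1n n2n]].
have [/andP[rn0 rn1] Frn0 nkn] := r_n n n1n.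
move=> [i [_ grid]]; have := grid _ (truncn_grid_le (kk n) u01).
rewrite -/(grid_floor (kk n) u) => lt_grid.
exists (- (i%:R * (kk n).+1%:R^-1)); first by rewrite oppr_le0 divr_ge0.
have rho : F (r n * grid_floor (kk n) u) / F (r n) <= psi u + e / 3 / C.
  apply: le_trans (ratio_n n n0n); rewrite ler_pM2r ?invr_gt0//; apply: F_nd.
  - by rewrite mulr_ge0 ?grid_floor_ge0// ltW.
  - by rewrite ler_pM2l// grid_floor_le.
  - by rewrite mulr_ile1// ltW.
have {}rho : C * (F (r n * grid_floor (kk n) u) / F (r n)) <= C * psi u + e / 3.
  rewrite -(ler_pM2l C0) mulrDr in rho; apply: le_trans rho _.
  by rewrite [C * (_ / C)]mulrCA divff ?mulr1// gt_eqF.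
have invn : n.+1%:R^-1 < e / 3 by exact: (inv_n n n2n).
move: rho lt_grid invn (ku _ (leq_trans k0n nkn)).
move: (grid_floor (kk n) u) (n.+1%:R^-1) (i%:R * _) => v z s.
by move: (F _ / F _) => rho; lra.
Qed.

(** * The limit in n *)

Lemma inv_sqrtn_lt (R : realType) (e : R) : 0 < e ->
  \forall n \near \oo, (Num.sqrt n%:R)^-1 < e.
Proof.
move=> e0; near=> n.
have n_large : e^-1 ^+ 2 < n%:R by near: n; exact: nbhs_infty_gtr.
have -> : e = (Num.sqrt (e^-1 ^+ 2))^-1.
  by rewrite sqrtr_sqr ger0_norm ?invrK// invr_ge0 ltW.
rewrite ltf_pV2 ?posrE ?sqrtr_gt0 ?exprn_gt0 ?invr_gt0//; last first.
  by apply: lt_trans n_large; rewrite exprn_gt0// invr_gt0.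
by rewrite ltr_sqrt// (le_lt_trans _ n_large)// sqr_ge0.
Unshelve. all: by end_near. Qed.

(** The choice of N, the largest number of steps that fit into [0, 1 / r], keeps
    the rescaled nodes in [-1, 1], where W is known to be a Brownian motion. *)
Lemma grid_law_scaled (R : realType)
    d (T : measurableType d) (P : probability T R) (W : R -> {RV P >-> R})
    d' (T' : measurableType d') (P' : probability T' R)
    (W' : R -> {RV P' >-> R})
    (r : R) (k : nat) (alpha beta : nat -> R) :
  brownian_motion `[-1, 1] W -> brownian_motion [set: R] W' -> 0 < r <= 1 ->
  let N := Num.truncn (k.+1%:R / r) in
  P [set w | grid_event N k.+1 k.+1%:R^-1 alpha beta
       (fun t => (Num.sqrt r)^-1 * W (r * t) w)] =
  P' [set w | grid_event N k.+1 k.+1%:R^-1 alpha beta (fun t => W' t w)].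
Proof.
move=> bW bW' /andP[r0 r1] N.
have h0 : 0 < k.+1%:R^-1 :> R by rewrite invr_gt0.
apply: (@grid_event_law R N k.+1 k.+1%:R^-1 alpha beta _ _ P _ _ P'
  (fun t w => (Num.sqrt r)^-1 * W (r * t) w) (fun t w => W' t w)).
- by move=> t; apply: measurable_funM.
- by move=> t.
- apply: (brownian_motion_grid bW h0 r0) => i iN.
  have Nr : N%:R <= k.+1%:R / r by rewrite truncn_le divr_ge0// ltW.
  have iK : i%:R - N%:R <= k.+1%:R :> R by rewrite lerBlDl -natrD ler_nat.
  have i0 : 0 <= i%:R :> R by [].
  rewrite /= in_itv/= mulrA ler_pdivrMr// mul1r ler_pdivlMr// mulN1r.
  move: Nr iK i0; rewrite ler_pdivlMr//.
  have k0 : 0 < k.+1%:R :> R by [].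
  move: (N%:R) (k.+1%:R) (i%:R) k0 => n K x K0 nrK xnK x0.
  by apply/andP; split; nra.
- have := @brownian_motion_grid R N (N + k.+1) k.+1%:R^-1 _ _ P' _ W' 1 bW' h0
    (@ltr01 R) (fun _ _ => I).
  have -> : (fun t w => (Num.sqrt 1)^-1 * W' (1 * t) w) = (fun t w => W' t w).
  by apply/funext => t; apply/funext => w; rewrite sqrtr1 invr1 !mul1r.
  exact: id.
Qed.

Lemma limsup_near_argmin (R : realType)
    d (T : measurableType d) (P : probability T R) (W : R -> {RV P >-> R})
    d' (T' : measurableType d') (P' : probability T' R)
    (W' : R -> {RV P' >-> R})
    (F psi : R -> R) (C : R) (a r : nat -> R) (A : nat -> set T) :
  brownian_motion `[-1, 1] W -> brownian_motion [set: R] W' ->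
  (forall t : R, t \in `[-1, 0] -> 0 <= F t) ->
  (forall x y : R, 0 <= x -> x <= y -> y <= 1 -> F x <= F y) ->
  (forall u v : R, 0 <= u -> u <= v -> v <= 1 -> psi u <= psi v) ->
  (forall u e : R, 0 <= u <= 1 -> 0 < e ->
    \forall n \near \oo, F (r n * u) / F (r n) <= psi u + e) ->
  0 < C ->
  (\forall n \near \oo, [/\ 0 < a n, 0 < r n <= 1, F (r n) = a n * r n &
     Num.sqrt (r n) * a n = C * (Num.sqrt n%:R)^-1]) ->
  (forall n, measurable (A n)) ->
  (forall n w, A n w ->
    near_argmin_left (white_noise_obs F n (fun t => W t w)) (a n)) ->
  (limn_esup (fun n => P (A n)) <=
   P' [set w | limit_event C psi (fun s => W' s w)])%E.
Proof.
move=> bW bW' F0 F_nd psi_nd ratioP C0 har mA Aargmin.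
pose good n := [/\ 0 < a n, 0 < r n <= 1, F (r n) = a n * r n &
     Num.sqrt (r n) * a n = C * (Num.sqrt n%:R)^-1].
pose G n k (X : R -> R) := grid_event (Num.truncn (k.+1%:R / r n)) k.+1 k.+1%:R^-1
      (fun i => C * (i%:R * k.+1%:R^-1))
      (fun j => - (C * (j%:R * k.+1%:R^-1 -
         F (r n * (j%:R * k.+1%:R^-1)) / F (r n))) + n.+1%:R^-1) X.
have mG' n k : measurable [set w | G n k (fun t => W' t w)].
  exact: (@measurable_grid_event R _ _ _ _ _ _ _ (fun t w => W' t w)).
have /choice[kk kkP] : forall n, exists k, good n -> (n <= k)%N /\
    (P (A n) <= P' [set w | G n k (fun t => W' t w)] + (n.+1%:R^-1)%:E)%E.
  move=> n.
  have [[a0 r01 Fr ra]|ngood] := pselect (good n); last by exists 0%N.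
  have [r0 r1] := andP r01.
  have kappa0 : 0 < (Num.sqrt n%:R)^-1 :> R.
    by rewrite -(pmulr_rgt0 _ C0) -ra mulr_gt0// sqrtr_gt0.
  have invn : 0 < n.+1%:R^-1 :> R by rewrite invr_gt0.
  have [|w Aw|k nk PA] := @probability_le_grid _ _ _ P (A n)
      (fun k => [set w | G n k (fun t => (Num.sqrt (r n))^-1 * W (r n * t) w)])
      n _ (mA n) _ invn.
  - move=> k; apply: (@measurable_grid_event R _ _ _ _ _ _ _
      (fun t w => (Num.sqrt (r n))^-1 * W (r n * t) w)) => t.
    exact: measurable_funM.
  - have [k0 near_k0] := near_argmin_grid (@bm_cont _ _ _ _ _ _ bW w)
      F0 kappa0 a0 r01 Fr ra (Aargmin n w Aw) invn.
    by exists k0 => k /near_k0.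
  exists k => _; split=> //; apply: (le_trans PA).
  by rewrite /G (grid_law_scaled _ _ _ bW bW' r01).
(* The equations for a and r hold from some n on; for the other n the whole space
   makes the bound trivial, and the upper limit of the sets ignores them. *)
pose E n :=
  if `[< good n >] then [set w | G n (kk n) (fun t => W' t w)] else setT.
have mE n : measurable (E n) by rewrite /E; case: ifP.
have PE n : (P (A n) <= P' (E n) + (n.+1%:R^-1)%:E)%E.
  rewrite /E; case: asboolP => [/kkP[]//|_].
  rewrite probability_setT; apply: (le_trans (probability_le1 P (mA n))).
  by rewrite -EFinD lee_fin lerDl invr_ge0.
apply: (le_trans (limn_esup_le_lim_sup_set mE PE)).
have cW' w : {within [set: R], continuous (fun t => W' t w)} by exact: bm_cont.
apply: le_measure; rewrite ?inE.
- apply: bigcap_measurableType => n _; exact: bigcup_measurable.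
- exact: (@measurable_limit_event R _ _ C psi (fun t w => W' t w)).
move=> w supE.
apply: (@grid_event_limit R F psi _ C r kk
  (fun n => Num.truncn ((kk n).+1%:R / r n))) => //.
- apply: filterS har => n gn; have [a0 r01 Fr _] := gn; split=> //.
    by rewrite Fr mulr_gt0//; case/andP: r01.
  by have [] := kkP n gn.
- move=> m; have [n0 _ good_n] := har.
  have [n /= + En] := supE (maxn m n0) I; rewrite geq_max => /andP[mn n0n].
  exists n => //; move: En; rewrite /E asboolT//; exact: good_n.
Qed.

(** * The functions psi_r and psi_l *)

Section psi.
Context (R : realType) (F : R -> R).
Hypothesis F_nd : forall x y : R, 0 <= x -> x <= y -> y <= 1 -> F x <= F y.
Hypothesis F_0 : F 0 = 0.

Let F_ge0 (t : R) : 0 <= t -> t <= 1 -> 0 <= F t.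
Proof. by move=> t0 t1; rewrite -F_0; apply: F_nd. Qed.

Let ratio u : R -> \bar R := fun t => (F (u * t) / F t)%:E.

Let ratio_ge0 (u t : R) : 0 <= u <= 1 -> 0 < t -> t <= 1 -> (0 <= ratio u t)%E.
Proof.
move=> /andP[u0 u1] t0 t1; rewrite lee_fin divr_ge0// F_ge0//; try lra.
  by rewrite mulr_ge0// ltW.
by rewrite mulr_ile1//; lra.
Qed.

Let ratio_le1 (u t : R) : 0 <= u <= 1 -> 0 < t -> t <= 1 -> (ratio u t <= 1)%E.
Proof.
move=> /andP[u0 u1] t0 t1; rewrite lee_fin.
have [->|Ft0] := eqVneq (F t) 0; first by rewrite invr0 mulr0.
have Ft : 0 < F t by rewrite lt_neqAle eq_sym Ft0/= F_ge0//; lra.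
by rewrite ler_pdivrMr// mul1r F_nd ?mulr_ge0//; nra.
Qed.

Let right_unit : \forall t \near (0 : R)^'+, 0 < t < 1.
Proof.
near=> t; apply/andP; split; near: t; first exact: nbhs_right_gt.
exact: nbhs_right_lt.
Unshelve. all: by end_near. Qed.

(** The ratios are ordered where F t >= 0, which is known on [0, 1] only; so the
    neighbourhoods in the upper limit are first cut down. *)
Let esup_le (u v : R) : 0 <= u -> u <= v -> v <= 1 ->
  (limf_esup (ratio u) 0^'+ <= limf_esup (ratio v) 0^'+)%E.
Proof.
move=> u0 uv v1; apply: le_ereal_inf_tmp => _ [V nV <-].
apply: (@le_trans _ _ (ereal_sup (ratio u @` (V `&` [set t | 0 < t < 1])))).
  apply: ereal_inf_lbound; exists (V `&` [set t | 0 < t < 1]) => //=.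
  exact: filterI.
apply: ub_ereal_sup => _ [t [Vt /= /andP[t0 t1]] <-].
apply: (@le_trans _ _ (ratio v t)); last by apply: ereal_sup_ubound; exists t.
rewrite lee_fin ler_wpM2r ?invr_ge0 ?F_ge0 ?(ltW t0) ?(ltW t1)//.
apply: F_nd; [by rewrite mulr_ge0// ltW|by rewrite ler_pM2r|].
by rewrite mulr_ile1//; lra.
Qed.

Let esup_fin (u : R) : 0 <= u <= 1 -> limf_esup (ratio u) 0^'+ \is a fin_num.
Proof.
move=> u01; rewrite ge0_fin_numE.
  apply: (@le_lt_trans _ _ 1%E); last exact: ltry.
  apply: (@le_trans _ _ (ereal_sup (ratio u @` [set t | 0 < t < 1]))).
    by apply: ereal_inf_lbound; exists [set t | 0 < t < 1].
  by apply: ub_ereal_sup => _ [t /= /andP[t0 /ltW t1] <-]; exact: ratio_le1.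
apply: le_ereal_inf_tmp => _ [V nV <-].
have [t [Vt /andP[t0 /ltW t1]]] := filter_ex (filterI nV right_unit).
apply: (@le_trans _ _ (ratio u t)); first exact: ratio_ge0.
by apply: ereal_sup_ubound; exists t.
Qed.

Lemma psi_r_nd (u v : R) : 0 <= u -> u <= v -> v <= 1 -> psi_r F u <= psi_r F v.
Proof.
move=> u0 uv v1; rewrite /psi_r; case: asboolP => _.
  by rewrite ler_nat; case: eqVneq => // u1; case: eqVneq => // v1'; lra.
apply: fine_le; last exact: esup_le.
  by apply: esup_fin; apply/andP; split=> //; lra.
by apply: esup_fin; apply/andP; split=> //; lra.
Qed.

(** Let z be the supremum of the zeros of F in [0, 1]. If z > 0, then r n need
    not tend to 0, but it is eventually below z / u for every u in ]0, 1[; so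
    r n * u is below z and the ratio vanishes, as does psi_r F u. If z = 0, then
    F (r n) -> 0 forces r n -> 0 from the right, and the upper limit in the
    definition of psi_r dominates the one along r n. *)
Lemma psi_r_limsup (r : nat -> R) (u e : R) :
  (\forall n \near \oo, 0 < r n <= 1) ->
  (forall x : R, 0 < x -> \forall n \near \oo, F (r n) < x) ->
  0 <= u <= 1 -> 0 < e ->
  \forall n \near \oo, F (r n * u) / F (r n) <= psi_r F u + e.
Proof.
move=> r01 Fr_small u01 e0; have /andP[u0 u1] := u01.
have r_small (x : R) : 0 < x -> (x <= 1 -> 0 < F x) ->
    \forall n \near \oo, r n < x \/ 1 < x.
  move=> x0 Fx0; have [x1|x1] := leP x 1; last by apply: nearW => n; right.
  have := Fr_small _ (Fx0 x1); apply: filterS2 r01 => n /andP[rn0 rn1] Frx; left.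
  rewrite ltNge; apply/negP => xr; move: Frx; apply/negP.
  by rewrite -leNgt F_nd// ltW.
have le1 n : 0 < r n <= 1 -> F (r n * u) / F (r n) <= 1.
  by move=> /andP[rn0 rn1]; rewrite mulrC -lee_fin mulrC [r n * u]mulrC ratio_le1.
rewrite /psi_r; case: asboolP => [[t /andP[t0 t1] Ft]|F_pos].
  have [u_eq1|u_neq1] := eqVneq u 1.
    apply: filterS r01 => n /le1 /le_trans; apply.
    by rewrite lerDl ltW.
  have ult1 : u < 1 by rewrite lt_neqAle u_neq1.
  have [u_eq0|u_neq0] := eqVneq u 0.
    by apply: nearW => n; rewrite u_eq0 mulr0 F_0 mul0r add0r ltW.
  have ugt0 : 0 < u by rewrite lt_neqAle eq_sym u_neq0.
  pose Z := [set z : R | 0 <= z <= 1 /\ F z = 0].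
  have supZ : has_sup Z.
    by split; [exists t; split=> //; lra|exists 1 => z [/andP[]]].
  have tZ : t <= sup Z by apply: sup_upper_bound => //; split=> //; lra.
  have Z1 : sup Z <= 1.
    by apply: sup_le_ub; [exists t; split=> //; lra|move=> z [/andP[]]].
  have su : sup Z < sup Z / u by rewrite ltr_pdivlMr// gtr_pMr//; lra.
  have := r_small (sup Z / u) ltac:(lra) _.
  have Fsu : sup Z / u <= 1 -> 0 < F (sup Z / u).
    move=> su1; rewrite lt_neqAle F_ge0 ?andbT//; last by lra.
    apply/eqP => Fsu; have : sup Z / u <= sup Z.
      by apply: sup_upper_bound => //; split; [apply/andP; split; lra|].
    by rewrite leNgt su.
  move=> /(_ Fsu); apply: filterS2 r01 => n /andP[rn0 rn1] rn_lt.
  have rnu : r n * u < sup Z.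
    by rewrite -ltr_pdivlMr//; case: rn_lt => // lt1; lra.
  have [z [/andP[z0 z1] Fz]] :=
    sup_adherent (ltac:(lra) : 0 < sup Z - r n * u) supZ.
  rewrite opprB addrCA subrr addr0 => rz.
  have -> : F (r n * u) = 0.
    apply/eqP; rewrite eq_le -{1}Fz F_nd ?mulr_ge0 ?(ltW rn0) ?(ltW rz)//=.
    by apply: F_ge0; [rewrite mulr_ge0// ltW|lra].
  by rewrite mul0r add0r ltW.
have := esup_fin u01; set L := limf_esup _ _ => Lfin.
have : (L < (fine L + e)%:E)%E by rewrite EFinD fineK// lteDl.
move=> /ereal_inf_lt[_ [V [d /= d0 dV] <-] supV].
have := r_small d d0 _.
have Fd : d <= 1 -> 0 < F d.
  move=> d1; rewrite lt_neqAle F_ge0 ?andbT//; last exact: ltW.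
  by apply/eqP => Fd; apply: F_pos; exists d => //; rewrite d0.
move=> /(_ Fd); apply: filterS2 r01 => n /andP[rn0 rn1] rn_lt.
have rnd : r n < d by case: rn_lt => // d1; lra.
have Vr : V (r n) by apply: dV => //=; rewrite sub0r normrN gtr0_norm.
rewrite -lee_fin; apply: le_trans (ltW supV); apply: ereal_sup_ubound.
by exists (r n) => //=; rewrite /ratio [u * _]mulrC.
Qed.

End psi.

Lemma psi_lE (R : realType) (F : R -> R) : psi_l F = psi_r (fun t => F (- t)).
Proof.
apply/funext => s; rewrite /psi_l /psi_r.
have -> : `[< exists2 t, -1 <= t < 0 & F t = 0 >] =
    `[< exists2 t, 0 < t <= 1 & F (- t) = 0 >].
  apply/asbool_equiv_eq; split=> -[t t01 Ft].
    by exists (- t); rewrite ?opprK//; lra.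
  by exists (- t) => //; lra.
case: ifP => // _; congr fine; rewrite -[in LHS]oppr0 at_leftN.
rewrite /limf_esup; congr ereal_inf; apply/seteqP; split=> _ [V nV <-].
  exists (-%R @^-1` V) => //; congr ereal_sup; apply/seteqP; split=> _ [t Vt <-].
    by exists (- t) => //; rewrite mulrN.
  by exists (- t); rewrite /= ?opprK// mulrN opprK.
exists (-%R @^-1` V); last first.
  congr ereal_sup; apply/seteqP; split=> _ [t Vt <-].
    by exists (- t) => //; rewrite mulrN !opprK.
  by exists (- t); rewrite /= ?opprK// mulrN.
rewrite /fmap/= (_ : -%R @^-1` _ = V)//.
by apply/seteqP; split=> t; rewrite /= opprK.
Qed.

Theorem theorem1p1 (R : realType)
  (* white noise on [-1, 1] *)
  (d : measure_display) (T : measurableType d) (P : probability T R)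
  (W : R -> {RV P >-> R}) (hW : brownian_motion `[-1, 1] W)
  (* Brownian motion on the whole line, for the limiting probabilities *)
  (d' : measure_display) (T' : measurableType d') (P' : probability T' R)
  (W' : R -> {RV P' >-> R}) (hW' : brownian_motion [set: R] W')
  (f0 : R -> R)
  (f0_nd : {in `[-1, 1] &, {homo f0 : x y / x <= y}})
  (f0_L2 : lebesgue_measure.-integrable `[-1, 1] (fun x => (f0 x ^+ 2)%:E))
  (f0_cont : {for 0, continuous f0})
  (f0_0 : f0 0 = 0)
  (F0_1 : 0 < primitive0 f0 1) (F0_N1 : 0 < primitive0 f0 (-1))
  (C : R) (C_gt0 : 0 < C)
  (a ra b rb : nat -> R)
  (h_a : \forall n \near \oo, [/\ 0 < a n, 0 < ra n <= 1,
     primitive0 f0 (ra n) = a n * ra n &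
     Num.sqrt (ra n) * a n = C * (Num.sqrt n%:R)^-1])
  (h_b : \forall n \near \oo, [/\ 0 < b n, 0 < rb n <= 1,
     primitive0 f0 (- rb n) = b n * rb n &
     Num.sqrt (rb n) * b n = C * (Num.sqrt n%:R)^-1]) :
  let fhat0 (n : nat) (w : T) : R :=
    monotone_lse (white_noise_obs (primitive0 f0) n (fun t => W t w)) 0 in
  (limn_esup (fun n => P [set w | (a n <= fhat0 n w)%R]) <=
     P' [set w | limit_event C (psi_r (primitive0 f0)) (fun s => W' s w)])%E /\
  (limn_esup (fun n => P [set w | (fhat0 n w <= - b n)%R]) <=
     P' [set w | limit_event C (psi_l (primitive0 f0)) (fun s => W' s w)])%E.
Proof.
move=> fhat0; set F := primitive0 f0.
have F_0 : F 0 = 0 := primitive0_0 f0.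
have F_ge0 t : t \in `[-1, 1] -> 0 <= F t := @primitive0_ge0 R f0 f0_nd f0_0 t.
have F_nd x y : 0 <= x -> x <= y -> y <= 1 -> F x <= F y :=
  @primitive0_nd R f0 f0_nd f0_0 x y.
have F_ni x y : 0 <= x -> x <= y -> y <= 1 -> F (- x) <= F (- y).
  by move=> x0 xy y1; apply: primitive0_ni => //; lra.
have obs_cont n w : {within `[-1, 1], continuous
    (white_noise_obs F n (fun t => W t w))}.
  move=> x; apply: cvgD; first exact: primitive0_cont.
  by apply: cvgM; [exact: cvg_cst|exact: (@bm_cont _ _ _ _ _ _ hW w)].
have mfhat n : measurable_fun setT (fhat0 n).
  apply: (@measurable_monotone_lse _ _ R
    (fun t w => white_noise_obs F n (fun t => W t w) t)) => // t.
  by apply: measurable_funD => //; exact: measurable_funM.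
have small (c r : nat -> R) (G : R -> R) (x : R) :
    (\forall n \near \oo, [/\ 0 < c n, 0 < r n <= 1, G (r n) = c n * r n &
       Num.sqrt (r n) * c n = C * (Num.sqrt n%:R)^-1]) ->
    0 < x -> \forall n \near \oo, G (r n) < x.
  move=> hcr x0; have := inv_sqrtn_lt (divr_gt0 x0 C_gt0).
  apply: filterS2 hcr => n [c0 /andP[r0 r1] -> rc]; rewrite ltr_pdivlMr// mulrC -rc.
  apply: le_lt_trans; rewrite mulrC ler_pM2r// -[X in X <= _]sqr_sqrtr ?(ltW r0)//.
  rewrite expr2 ler_piMl ?sqrtr_ge0//.
  by rewrite -sqrtr1 ler_sqrt.
have in_range (c r : nat -> R) (G : R -> R) :
    (\forall n \near \oo, [/\ 0 < c n, 0 < r n <= 1, G (r n) = c n * r n &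
       Num.sqrt (r n) * c n = C * (Num.sqrt n%:R)^-1]) ->
    \forall n \near \oo, 0 < r n <= 1.
  by apply: filterS => n [].
split.
- pose A n := [set w | a n <= fhat0 n w].
  have F_left t : t \in `[-1, 0] -> 0 <= F t.
    by move=> t10; apply: F_ge0; move: t10; rewrite !in_itv/=; lra.
  have F_psi u e : 0 <= u <= 1 -> 0 < e ->
      \forall n \near \oo, F (ra n * u) / F (ra n) <= psi_r F u + e.
    apply: psi_r_limsup F_nd F_0 _ _ _ (in_range a ra F h_a) _.
    by move=> x; exact: (small a ra F x h_a).
  have mA n : measurable (A n) by exact: measurable_ler_set.
  have A_argmin n w : A n w ->
      near_argmin_left (white_noise_obs F n (fun t => W t w)) (a n).
    exact: lse_ge_near_argmin.
  exact: (limsup_near_argmin hW hW' F_left F_nd (psi_r_nd F_nd F_0) F_psi C_gt0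
    h_a mA A_argmin).
rewrite psi_lE; pose FN t := F (- t).
have FN_0 : FN 0 = 0 by rewrite /FN oppr0.
have FN_left t : t \in `[-1, 0] -> 0 <= FN t.
  by move=> t10; apply: F_ge0; move: t10; rewrite !in_itv/=; lra.
have FN_psi u e : 0 <= u <= 1 -> 0 < e ->
    \forall n \near \oo, FN (rb n * u) / FN (rb n) <= psi_r FN u + e.
  apply: psi_r_limsup F_ni FN_0 _ _ _ (in_range b rb FN h_b) _.
  by move=> x; exact: (small b rb FN x h_b).
have hWN : brownian_motion `[-1, 1] (fun t => W (- t)).
  have := brownian_motion_reflect hW; congr (brownian_motion _ _).
  by apply/seteqP; split=> t /=; rewrite !in_itv/=; lra.
pose A n := [set w | fhat0 n w <= - b n].
have mA n : measurable (A n) by exact: measurable_ler_set.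
have A_argmin n w : A n w ->
    near_argmin_left (white_noise_obs FN n (fun t => W (- t) w)) (b n).
  exact: lse_le_near_argmin.
exact: (limsup_near_argmin hWN hW' FN_left F_ni (psi_r_nd F_ni FN_0) FN_psi C_gt0
  h_b mA A_argmin).
Qed.
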